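(* Let $f$ satisfy Assumption (M) with exponent $p>1+\frac2N$. Then there is a constant $C^-=C^-(f,N)>0$ such that for every $\varepsilon\in(0,1]$ and every $L>0$ with $L<C^-\varepsilon^{-\frac{p-1}{2}}$, the solution $u$ of $u_t=\Delta u+f(u)$ on $(0,\infty)\times\mathbb R^N$ with $u(0,x)=\varepsilon\mathbf 1_{B_L}(x)$ satisfies $\|u(t,\cdot)\|_{L^\infty(\mathbb R^N)}=\mathcal O(t^{-N/2})$ as $t\to+\infty$.
   Context: Assumption (M): $f:\mathbb R\to\mathbb R$ is locally Lipschitz continuous, $f=0$ on $(-\infty,0]\cup[1,\infty)$, $f(u)>0$ for all $u\in(0,1)$, and for some $p>1$, $0<\liminf_{u\to0^+}f(u)/u^p\le\limsup_{u\to0^+}f(u)/u^p<+\infty$. $B_L$ is the open ball of radius $L$ centred at $0$ in $\mathbb R^N$. *)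

(* Defs.v *)
From Stdlib Require Import Reals Lra.
From Stdlib Require Fin.
Open Scope R_scope.

Definition RN (N : nat) := Fin.t N -> R.

Fixpoint sumFin (N : nat) : (Fin.t N -> R) -> R :=
  match N return (Fin.t N -> R) -> R with
  | O => fun _ => 0
  | S n => fun g => g Fin.F1 + sumFin n (fun i => g (Fin.FS i))
  end.

Definition normN {N : nat} (x : RN N) : R := sqrt (sumFin N (fun i => x i * x i)).
Definition distN {N : nat} (x y : RN N) : R := normN (fun i => x i - y i).

Definition upd {N : nat} (x : RN N) (i : Fin.t N) (h : R) : RN N :=
  fun j => if Fin.eq_dec i j then x j + h else x j.

Definition ball_ind {N : nat} (L : R) (x : RN N) : R :=
  if Rlt_dec (normN x) L then 1 else 0.

Definition locally_lipschitz (f : R -> R) : Prop :=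
  forall a b : R, exists K : R, forall x y : R,
    a <= x <= b -> a <= y <= b -> Rabs (f x - f y) <= K * Rabs (x - y).

(* 0 < liminf_{u->0+} f(u)/u^p <= limsup_{u->0+} f(u)/u^p < +oo, written out *)
Definition assumption_M (f : R -> R) (p : R) : Prop :=
  locally_lipschitz f /\
  (forall u, u <= 0 -> f u = 0) /\
  (forall u, 1 <= u -> f u = 0) /\
  (forall u, 0 < u < 1 -> 0 < f u) /\
  1 < p /\
  exists c1 c2 delta : R, 0 < c1 /\ 0 < c2 /\ 0 < delta /\
    forall u, 0 < u < delta -> c1 * Rpower u p <= f u <= c2 * Rpower u p.

Definition cont_pos {N : nat} (g : R -> RN N -> R) : Prop :=
  forall t x, 0 < t -> forall eps, 0 < eps -> exists delta, 0 < delta /\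
    forall s y, 0 < s -> Rabs (s - t) < delta -> distN y x < delta ->
      Rabs (g s y - g t x) < eps.

(** Bounded classical (C^{1,2}) solution of u_t = Δu + f(u) on (0,oo) x R^N
    with initial trace u0: u(t,x) -> u0(x) as t -> 0+ at every x off a given
    exceptional set [exc] (here the sphere |x| = L, a null set). *)
Definition classical_solution {N : nat} (f : R -> R) (u0 : RN N -> R)
    (exc : RN N -> Prop) (u : R -> RN N -> R) : Prop :=
  (exists M, forall t x, 0 < t -> Rabs (u t x) <= M) /\
  exists (ut : R -> RN N -> R) (d1 : Fin.t N -> R -> RN N -> R)
         (d2 : Fin.t N -> Fin.t N -> R -> RN N -> R),
    cont_pos u /\ cont_pos ut /\ (forall i, cont_pos (d1 i)) /\
    (forall i j, cont_pos (d2 i j)) /\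
    (forall t x, 0 < t -> derivable_pt_lim (fun s => u s x) t (ut t x)) /\
    (forall i t x, 0 < t ->
       derivable_pt_lim (fun h => u t (upd x i h)) 0 (d1 i t x)) /\
    (forall i j t x, 0 < t ->
       derivable_pt_lim (fun h => d1 i t (upd x j h)) 0 (d2 i j t x)) /\
    (forall t x, 0 < t ->
       ut t x = sumFin N (fun i => d2 i i t x) + f (u t x)) /\
    (forall x, ~ exc x -> forall eps, 0 < eps -> exists delta, 0 < delta /\
       forall t, 0 < t < delta -> Rabs (u t x - u0 x) < eps).

(* Main.v *)
Require Import Defs.
From Stdlib Require Import Reals Lra Lia List.
From Stdlib Require Import Classical ClassicalEpsilon FunctionalExtensionality.
From Coquelicot Require Import Coquelicot.
Open Scope R_scope.

(** The nonlinearity satisfies [f u <= C u^p], and [k = N (p - 1) / 2 > 1].  With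
    [s = L^2], the function
    [W = 2 eps (2 - (1 + t/s)^(1-k)) (1 + t/s)^(-N/2) exp (- |x|^2 / (4 (t + s)))]
    is a supersolution lying above the initial datum as soon as
    [L^2 <= const * eps^(-(p-1))], and it decays like [t^(-N/2)].

    The initial trace is only attained pointwise off a sphere, so [u <= W] needs a
    comparison principle for such traces.  The function
    [v = exp (-3 K t) ((u - W)^+)^3] is a bounded classical subsolution of the heat
    equation with zero trace off the sphere.  Its averages over unit segments, taken
    successively in all coordinate directions, are still subsolutions and are
    uniformly Lipschitz in space; by bounded convergence on segments (a line meets
    the sphere in at most two points) they tend to [0] everywhere, hence locally
    uniformly, and the classical maximum principle gives [v = 0]. *)

(** * Finite sums, coordinate shifts and compactness of boxes *)

(** The obstacle is the initial trace: convergence as t -> 0 is given at single points, without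
    uniformity in x, whereas a maximum principle has to start from uniform smallness. Averaging
    supplies the uniformity, and it preserves the differential inequality because the heat operator
    commutes with translations; segments instead of balls keep every integral one-dimensional. The
    constants of W answer two demands. With s = L^2 the Gaussian stays above 1/2 on the ball for
    short times, whence the factor 2 eps. The growing amplitude leaves W_t - ΔW equal to 2 eps
    (k-1)/s (1+t/s)^(-k) times the Gaussian, while W <= 4 eps times the Gaussian bounds the source
    by C (4 eps)^p (1+t/s)^(-k) times the Gaussian. The former dominates once L^2 <= (k-1) / (2 C (4
    eps)^(p-1)), and k > 1 is exactly p > 1 + 2/N. *)

Lemma sumFin_ext (N : nat) (g h : Fin.t N -> R) :
  (forall i, g i = h i) -> sumFin N g = sumFin N h.
Proof.
  intros H. f_equal. now apply functional_extensionality.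
Qed.

Lemma sumFin_le (N : nat) (g h : Fin.t N -> R) :
  (forall i, g i <= h i) -> sumFin N g <= sumFin N h.
Proof.
  induction N as [|N IH]; simpl; intros H; [lra|].
  apply Rplus_le_compat; [apply H | apply IH; intros i; apply H].
Qed.

Lemma sumFin_plus (N : nat) (g h : Fin.t N -> R) :
  sumFin N (fun i => g i + h i) = sumFin N g + sumFin N h.
Proof.
  induction N as [|N IH]; simpl; [lra|].
  rewrite (IH (fun i => g (Fin.FS i)) (fun i => h (Fin.FS i))). lra.
Qed.

Lemma sumFin_scal (N : nat) (c : R) (g : Fin.t N -> R) :
  sumFin N (fun i => c * g i) = c * sumFin N g.
Proof.
  induction N as [|N IH]; simpl; [lra|].
  rewrite (IH (fun i => g (Fin.FS i))). lra.
Qed.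

Lemma sumFin_const (N : nat) (c : R) : sumFin N (fun _ => c) = INR N * c.
Proof.
  induction N as [|N IH]; [simpl; lra|].
  rewrite S_INR. simpl. rewrite IH. lra.
Qed.

Lemma sumFin_ge0 (N : nat) (g : Fin.t N -> R) :
  (forall i, 0 <= g i) -> 0 <= sumFin N g.
Proof.
  intros H. replace 0 with (sumFin N (fun _ => 0)); [now apply sumFin_le|].
  rewrite sumFin_const. lra.
Qed.

Lemma sumFin_ge_term (N : nat) (g : Fin.t N -> R) (i : Fin.t N) :
  (forall j, 0 <= g j) -> g i <= sumFin N g.
Proof.
  intros H. induction i as [n|n i IH]; simpl.
  - pose proof (sumFin_ge0 n (fun i => g (Fin.FS i)) (fun i => H _)). lra.
  - pose proof (IH (fun i => g (Fin.FS i)) (fun i => H _)).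
    pose proof (H Fin.F1). simpl in *. lra.
Qed.

Lemma sumFin_sqr_le (N : nat) (g : Fin.t N -> R) :
  (forall i, 0 <= g i) -> sumFin N (fun i => g i * g i) <= sumFin N g * sumFin N g.
Proof.
  induction N as [|N IH]; simpl; intros H; [lra|].
  pose proof (IH (fun i => g (Fin.FS i)) (fun i => H _)) as H1.
  pose proof (sumFin_ge0 N (fun i => g (Fin.FS i)) (fun i => H _)).
  pose proof (H Fin.F1). simpl in *. nra.
Qed.

Lemma normN_le_sum (N : nat) (x : RN N) : normN x <= sumFin N (fun i => Rabs (x i)).
Proof.
  unfold normN.
  pose proof (sumFin_ge0 N (fun i => Rabs (x i)) (fun i => Rabs_pos _)) as H0.
  rewrite <- (sqrt_square _ H0). apply sqrt_le_1_alt.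
  eapply Rle_trans; [|apply (sumFin_sqr_le N (fun i => Rabs (x i))); intros; apply Rabs_pos].
  apply sumFin_le. intros i. rewrite <- Rabs_mult, Rabs_pos_eq; [lra|nra].
Qed.

Lemma upd_same (N : nat) (x : RN N) (i : Fin.t N) (h : R) : upd x i h i = x i + h.
Proof. unfold upd. destruct (Fin.eq_dec i i); [easy|congruence]. Qed.

Lemma upd_diff (N : nat) (x : RN N) (i j : Fin.t N) (h : R) :
  i <> j -> upd x i h j = x j.
Proof. unfold upd. now destruct (Fin.eq_dec i j). Qed.

Lemma upd_0 (N : nat) (x : RN N) (i : Fin.t N) : upd x i 0 = x.
Proof.
  apply functional_extensionality. intros j. unfold upd.
  destruct (Fin.eq_dec i j); lra.
Qed.

Lemma upd_add (N : nat) (x : RN N) (i : Fin.t N) (h k : R) :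
  upd (upd x i h) i k = upd x i (h + k).
Proof.
  apply functional_extensionality. intros j. unfold upd.
  destruct (Fin.eq_dec i j); lra.
Qed.

Lemma upd_comm (N : nat) (x : RN N) (i j : Fin.t N) (h k : R) :
  upd (upd x i h) j k = upd (upd x j k) i h.
Proof.
  apply functional_extensionality. intros l. unfold upd.
  destruct (Fin.eq_dec i l), (Fin.eq_dec j l); lra.
Qed.

Lemma upd_close (N : nat) (x y : RN N) (i : Fin.t N) (h k d e : R) :
  0 <= e -> (forall j, Rabs (y j - x j) < d) -> Rabs (k - h) <= e ->
  forall j, Rabs (upd y i k j - upd x i h j) < d + e.
Proof.
  intros He Hd Hk j. specialize (Hd j). unfold upd.
  destruct (Fin.eq_dec i j); [|lra].
  replace (y j + k - (x j + h)) with ((y j - x j) + (k - h)) by ring.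
  pose proof (Rabs_triang (y j - x j) (k - h)). lra.
Qed.

Lemma sumFin_sqr_upd (N : nat) (x : RN N) (i : Fin.t N) (h : R) :
  sumFin N (fun j => upd x i h j * upd x i h j) =
  sumFin N (fun j => x j * x j) + 2 * x i * h + h * h.
Proof.
  induction i as [n|n i IH]; simpl.
  - rewrite upd_same, (sumFin_ext n _ (fun j => x (Fin.FS j) * x (Fin.FS j))).
    + ring.
    + intros j. now rewrite upd_diff.
  - rewrite upd_diff by congruence.
    rewrite (sumFin_ext n _ (fun j => upd (fun k => x (Fin.FS k)) i h j *
      upd (fun k => x (Fin.FS k)) i h j)).
    + rewrite IH. ring.
    + intros j. destruct (Fin.eq_dec i j) as [<-|H].
      * now rewrite !upd_same.
      * rewrite !upd_diff; [easy|easy|]. intros E. now apply Fin.FS_inj in E.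
Qed.

(** * Tuples, uniform gauges on boxes and attained maxima *)

Definition consR {n : nat} (a : R) (x : RN n) : RN (S n) :=
  fun i => Fin.caseS' i (fun _ => R) a x.

Lemma consR_eta (n : nat) (x : RN (S n)) : consR (x Fin.F1) (fun i => x (Fin.FS i)) = x.
Proof.
  apply functional_extensionality. intros i. now apply (Fin.caseS' i).
Qed.

(** Coquelicot states compactness of boxes for nested pairs; [toTn] and [ofTn] pass between these
    and functions on [Fin.t]. *)
Fixpoint toTn (n : nat) : RN n -> Compactness.Tn n R :=
  match n return RN n -> Compactness.Tn n R with
  | O => fun _ => tt
  | S m => fun x => (x Fin.F1, toTn m (fun i => x (Fin.FS i)))
  end.

Fixpoint ofTn (n : nat) : Compactness.Tn n R -> RN n :=
  match n return Compactness.Tn n R -> RN n with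
  | O => fun _ _ => 0
  | S m => fun z => consR (fst z) (ofTn m (snd z))
  end.

Lemma bounded_toTn (n : nat) (a b x : RN n) :
  (forall i, a i <= x i <= b i) -> bounded_n n (toTn n a) (toTn n b) (toTn n x).
Proof.
  induction n as [|n IH]; simpl; intros H; [easy|].
  split; [apply H | apply IH; intros i; apply H].
Qed.

Lemma bounded_ofTn (n : nat) (a b : RN n) (z : Compactness.Tn n R) :
  bounded_n n (toTn n a) (toTn n b) z -> forall i, a i <= ofTn n z i <= b i.
Proof.
  induction n as [|n IH]; simpl; intros H i; [pattern i; apply Fin.case0|].
  destruct z as [z1 z2], H as [H1 H2].
  apply (Fin.caseS' i); simpl; [easy|]. intros j.
  apply (IH (fun i => a (Fin.FS i)) (fun i => b (Fin.FS i)) z2 H2).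
Qed.

Lemma close_ofTn (n : nat) (d : R) (x : RN n) (z : Compactness.Tn n R) :
  close_n n d (toTn n x) z -> forall i, Rabs (x i - ofTn n z i) < d.
Proof.
  induction n as [|n IH]; simpl; intros H i; [pattern i; apply Fin.case0|].
  destruct z as [z1 z2], H as [H1 H2].
  apply (Fin.caseS' i); simpl; [easy|]. intros j.
  apply (IH (fun i => x (Fin.FS i)) z2 H2).
Qed.

(** Compactness in gauge form: every point is covered from a centre whose radius stays above one
    common [d]. [Q] carries whatever local information is attached to a centre and its radius, so
    the same lemma yields extreme values, Dini's theorem and uniform continuity along segments. *)
Lemma box_gauge (n : nat) (a b : RN n) (Q : RN n -> R -> Prop) :
  (forall x, exists d, 0 < d /\ Q x d) ->
  exists d, 0 < d /\ forall y, (forall i, a i <= y i <= b i) ->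
    exists x e, (forall i, a i <= x i <= b i) /\ Q x e /\ d <= e /\
      forall i, Rabs (y i - x i) < e.
Proof.
  intros H.
  pose (dl := fun x => proj1_sig (constructive_indefinite_description _ (H x))).
  assert (Hdl : forall x, 0 < dl x /\ Q x (dl x)).
  { intros x. unfold dl. now destruct (constructive_indefinite_description _ (H x)). }
  destruct (compactness_value n (toTn n a) (toTn n b)
    (fun z => mkposreal (dl (ofTn n z)) (proj1 (Hdl _)))) as [d Hd].
  exists d. split; [apply cond_pos|]. intros y Hy.
  (* [compactness_value] provides the centre only under a double negation, hence the classical case
     distinction. *)
  destruct (excluded_middle_informative (exists t : Compactness.Tn n R,
     bounded_n n (toTn n a) (toTn n b) t /\
     close_n n (dl (ofTn n t)) (toTn n y) t /\ d <= dl (ofTn n t))) as [[t Ht]|K].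
  - destruct Ht as (H1 & H2 & H3).
    exists (ofTn n t), (dl (ofTn n t)). repeat split.
    + now apply (bounded_ofTn n a b t).
    + now apply (bounded_ofTn n a b t).
    + apply Hdl.
    + easy.
    + intros i. now apply close_ofTn.
  - exfalso. exact (Hd (toTn n y) (bounded_toTn n a b y Hy) K).
Qed.

Lemma interval_gauge (a b : R) (Q : R -> R -> Prop) :
  (forall x, exists d, 0 < d /\ Q x d) ->
  exists d, 0 < d /\ forall y, a <= y <= b ->
    exists x e, a <= x <= b /\ Q x e /\ d <= e /\ Rabs (y - x) < e.
Proof.
  intros H.
  destruct (box_gauge 1 (fun _ => a) (fun _ => b) (fun x => Q (x Fin.F1))) as (d & Hd & K).
  { intros x. apply H. }
  exists d. split; [easy|]. intros y Hy.
  destruct (K (fun _ => y) (fun _ => Hy)) as (x & e & H1 & H2 & H3 & H4).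
  exists (x Fin.F1), e. auto.
Qed.

(** Closeness is measured coordinate by coordinate, which suits shifts and boxes. The time [s]
    carries no sign condition: a radius at most [t] already keeps it positive. *)
Definition ccont {N : nat} (g : R -> RN N -> R) : Prop :=
  forall t x, 0 < t -> forall eps, 0 < eps -> exists delta, 0 < delta /\
    forall s y, Rabs (s - t) < delta -> (forall i, Rabs (y i - x i) < delta) ->
      Rabs (g s y - g t x) < eps.

Lemma cont_pos_ccont (N : nat) (g : R -> RN N -> R) : cont_pos g -> ccont g.
Proof.
  intros H t x Ht eps Heps.
  destruct (H t x Ht eps Heps) as (d & Hd & K).
  assert (HN : 0 < INR N + 1) by (pose proof (pos_INR N); lra).
  (* The Euclidean distance is at most the sum of the [N] coordinate differences; the [+ 1] keeps
     the quotient meaningful for [N = 0] and the final inequality strict. *)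
  pose (e := d / (INR N + 1)).
  assert (He : 0 < e) by (now apply Rdiv_lt_0_compat).
  assert (Hde : d = e * (INR N + 1)) by (unfold e; field; lra).
  exists (Rmin t e). split; [now apply Rmin_pos|].
  intros s y Hs Hy.
  pose proof (Rmin_l t e). pose proof (Rmin_r t e). pose proof (pos_INR N).
  apply K.
  - apply Rabs_def2 in Hs. lra.
  - nra.
  - unfold distN. eapply Rle_lt_trans; [apply normN_le_sum|].
    apply Rle_lt_trans with (sumFin N (fun _ => e)).
    + apply sumFin_le. intros i. specialize (Hy i). lra.
    + rewrite sumFin_const. lra.
Qed.

(** Two gauges. Radii at most 1 / (|F x| + 1) turn the common lower bound on radii into an upper
    bound for [F]. If the supremum [S] were not attained, radii [d] with [F <= S - d] nearby would
    lower the supremum itself. *)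
Lemma box_max (n : nat) (a b : RN n) (F : RN n -> R) (x0 : RN n) :
  (forall i, a i <= x0 i <= b i) ->
  (forall x, (forall i, a i <= x i <= b i) -> forall eps, 0 < eps ->
     exists d, 0 < d /\ forall y, (forall i, Rabs (y i - x i) < d) -> Rabs (F y - F x) < eps) ->
  exists x, (forall i, a i <= x i <= b i) /\
    forall y, (forall i, a i <= y i <= b i) -> F y <= F x.
Proof.
  intros Hx0 HF.
  pose (E := fun r => exists x, (forall i, a i <= x i <= b i) /\ r = F x).
  assert (HE : bound E).
  { destruct (box_gauge n a b (fun x d => (forall i, a i <= x i <= b i) ->
      d <= / (Rabs (F x) + 1) /\
      forall y, (forall i, Rabs (y i - x i) < d) -> Rabs (F y - F x) < 1)) as (d & Hd & K).
    { intros x. destruct (excluded_middle_informative (forall i, a i <= x i <= b i)) as [Hx|Hx].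
      - destruct (HF x Hx 1 Rlt_0_1) as (d & Hd & K).
        pose proof (Rabs_pos (F x)).
        assert (0 < / (Rabs (F x) + 1)) by (apply Rinv_0_lt_compat; lra).
        exists (Rmin d (/ (Rabs (F x) + 1))). split; [now apply Rmin_pos|].
        intros _. split; [apply Rmin_r|]. intros y Hy. apply K. intros i.
        eapply Rlt_le_trans; [apply Hy|apply Rmin_l].
      - exists 1. split; [lra|easy]. }
    exists (/ d + 1). intros r (y & Hy & ->).
    destruct (K y Hy) as (x & e & H1 & H2 & H3 & H4).
    destruct (H2 H1) as [H5 H6]. specialize (H6 y H4).
    pose proof (Rabs_pos (F x)).
    assert (Rabs (F x) + 1 <= / d).
    { rewrite <- (Rinv_inv (Rabs (F x) + 1)). apply Rinv_le_contravar; lra. }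
    apply Rabs_def2 in H6. pose proof (Rle_abs (F x)). lra. }
  destruct (completeness E HE) as (S & HS1 & HS2).
  { exists (F x0), x0. auto. }
  apply NNPP. intros Hno.
  assert (Hlt : forall x, (forall i, a i <= x i <= b i) -> F x < S).
  { intros x Hx. destruct (Rle_lt_or_eq_dec (F x) S) as [?|Heq]; [apply HS1; now exists x|easy|].
    exfalso. apply Hno. exists x. split; [easy|]. intros y Hy. rewrite Heq.
    apply HS1. now exists y. }
  destruct (box_gauge n a b (fun x d => (forall i, a i <= x i <= b i) ->
      forall y, (forall i, Rabs (y i - x i) < d) -> F y <= S - d)) as (d & Hd & K).
  { intros x. destruct (excluded_middle_informative (forall i, a i <= x i <= b i)) as [Hx|Hx].
    - pose proof (Hlt x Hx).
      destruct (HF x Hx ((S - F x) / 2)) as (d & Hd & K); [lra|].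
      exists (Rmin d ((S - F x) / 2)). split; [apply Rmin_pos; lra|].
      intros _ y Hy. pose proof (Rmin_r d ((S - F x) / 2)).
      assert (Rabs (F y - F x) < (S - F x) / 2) as HH.
      { apply K. intros i. eapply Rlt_le_trans; [apply Hy|apply Rmin_l]. }
      apply Rabs_def2 in HH. lra.
    - exists 1. split; [lra|easy]. }
  assert (S <= S - d); [|lra].
  apply HS2. intros r (y & Hy & ->).
  destruct (K y Hy) as (x & e & H1 & H2 & H3 & H4).
  specialize (H2 H1 y H4). lra.
Qed.

(** * Bounded convergence for Riemann integrals *)

Definition cont_on_R (f : R -> R) : Prop := forall x, continuous f x.

Lemma cont_ex_RInt (f : R -> R) (a b : R) : cont_on_R f -> ex_RInt f a b.
Proof. intros H. apply (ex_RInt_continuous (V := R_CompleteNormedModule)). intros; apply H. Qed.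

Lemma cont_eps (f : R -> R) (x : R) : continuous f x ->
  forall eps, 0 < eps -> exists d, 0 < d /\
    forall y, Rabs (y - x) < d -> Rabs (f y - f x) < eps.
Proof.
  intros H eps Heps.
  apply continuity_pt_filterlim in H.
  destruct (H eps Heps) as (d & Hd & K).
  exists d. split; [easy|]. intros y Hy.
  destruct (Req_dec y x) as [->|Hne].
  - now rewrite Rminus_diag, Rabs_R0.
  - apply K. repeat split; auto.
Qed.

Lemma eps_cont (f : R -> R) (x : R) :
  (forall eps, 0 < eps -> exists d, 0 < d /\
    forall y, Rabs (y - x) < d -> Rabs (f y - f x) < eps) -> continuous f x.
Proof.
  intros H. apply continuity_pt_filterlim. intros eps Heps.
  destruct (H eps Heps) as (d & Hd & K).
  exists d. split; [easy|]. intros y [_ Hy]. now apply K.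
Qed.

Lemma Rmin_plus_max (a b : R) : Rmin a b = a + b - Rmax a b.
Proof. unfold Rmin, Rmax. destruct (Rle_dec a b); lra. Qed.

Lemma cont_Rmax (f g : R -> R) :
  cont_on_R f -> cont_on_R g -> cont_on_R (fun x => Rmax (f x) (g x)).
Proof.
  intros Hf Hg x. apply eps_cont. intros eps Heps.
  destruct (cont_eps f x (Hf x) eps Heps) as (d1 & Hd1 & K1).
  destruct (cont_eps g x (Hg x) eps Heps) as (d2 & Hd2 & K2).
  exists (Rmin d1 d2). split; [now apply Rmin_pos|]. intros y Hy.
  pose proof (Rmin_l d1 d2). pose proof (Rmin_r d1 d2).
  specialize (K1 y ltac:(lra)). specialize (K2 y ltac:(lra)).
  apply Rabs_def2 in K1. apply Rabs_def2 in K2.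
  apply Rabs_def1; unfold Rmax; destruct (Rle_dec (f y) (g y)), (Rle_dec (f x) (g x)); lra.
Qed.

Lemma cont_Rmin (f g : R -> R) :
  cont_on_R f -> cont_on_R g -> cont_on_R (fun x => Rmin (f x) (g x)).
Proof.
  intros Hf Hg x.
  apply continuous_ext with (fun x => minus (plus (f x) (g x)) (Rmax (f x) (g x))).
  { intros y. now rewrite Rmin_plus_max. }
  apply (continuous_minus (V := R_NormedModule)).
  - apply (continuous_plus (V := R_NormedModule)); [apply Hf|apply Hg].
  - now apply cont_Rmax.
Qed.

Lemma RInt_le_cont (f g : R -> R) :
  cont_on_R f -> cont_on_R g -> (forall x, 0 <= x <= 1 -> f x <= g x) ->
  RInt f 0 1 <= RInt g 0 1.
Proof.
  intros Hf Hg H. apply RInt_le; [lra|now apply cont_ex_RInt|now apply cont_ex_RInt|].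
  intros x Hx. apply H. lra.
Qed.

Lemma RInt_le_bound (f : R -> R) (c : R) :
  cont_on_R f -> (forall x, 0 <= x <= 1 -> f x <= c) -> RInt f 0 1 <= c.
Proof.
  intros Hf H. replace c with (RInt (fun _ => c) 0 1).
  - apply RInt_le_cont; [easy| |easy]. intros x. apply continuous_const.
  - rewrite RInt_const. unfold scal; simpl; unfold mult; simpl. ring.
Qed.

Lemma RInt_ge_bound (f : R -> R) (c : R) :
  cont_on_R f -> (forall x, 0 <= x <= 1 -> c <= f x) -> c <= RInt f 0 1.
Proof.
  intros Hf H. replace c with (RInt (fun _ => c) 0 1).
  - apply RInt_le_cont; [ |easy|easy]. intros x. apply continuous_const.
  - rewrite RInt_const. unfold scal; simpl; unfold mult; simpl. ring.
Qed.

Lemma RInt_plus_cont (f g : R -> R) :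
  cont_on_R f -> cont_on_R g ->
  RInt (fun x => f x + g x) 0 1 = RInt f 0 1 + RInt g 0 1.
Proof. intros Hf Hg. apply (RInt_plus f g); now apply cont_ex_RInt. Qed.

Lemma RInt_minus_cont (f g : R -> R) :
  cont_on_R f -> cont_on_R g ->
  RInt (fun x => f x - g x) 0 1 = RInt f 0 1 - RInt g 0 1.
Proof. intros Hf Hg. apply (RInt_minus f g); now apply cont_ex_RInt. Qed.

Lemma RInt_min_max (f g : R -> R) :
  cont_on_R f -> cont_on_R g ->
  RInt (fun x => Rmin (f x) (g x)) 0 1 =
  RInt f 0 1 + RInt g 0 1 - RInt (fun x => Rmax (f x) (g x)) 0 1.
Proof.
  intros Hf Hg.
  rewrite <- RInt_plus_cont by easy.
  rewrite <- RInt_minus_cont.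
  - apply RInt_ext. intros x _. apply Rmin_plus_max.
  - intros x. apply (continuous_plus (V := R_NormedModule)); [apply Hf|apply Hg].
  - now apply cont_Rmax.
Qed.

Fixpoint max_from (f : nat -> R -> R) (n m : nat) (x : R) : R :=
  match m with
  | O => f n x
  | S k => Rmax (max_from f n k x) (f (n + S k)%nat x)
  end.

Fixpoint min_upto (h : nat -> R -> R) (n : nat) (x : R) : R :=
  match n with
  | O => h O x
  | S k => Rmin (min_upto h k x) (h (S k) x)
  end.

Lemma max_from_cont f n m : (forall k, cont_on_R (f k)) -> cont_on_R (max_from f n m).
Proof.
  intros H. induction m as [|m IH]; [apply H|]. now apply cont_Rmax.
Qed.

Lemma min_upto_cont h n : (forall k, cont_on_R (h k)) -> cont_on_R (min_upto h n).
Proof.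
  intros H. induction n as [|n IH]; [apply H|]. now apply cont_Rmin.
Qed.

Lemma max_from_lub f n m x c :
  (forall k, (n <= k)%nat -> f k x <= c) -> max_from f n m x <= c.
Proof.
  intros H. induction m as [|m IH]; simpl.
  - apply H. lia.
  - apply Rmax_lub; [easy|]. apply H. lia.
Qed.

Lemma max_from_lt f n m x c :
  (forall k, (n <= k)%nat -> f k x < c) -> max_from f n m x < c.
Proof.
  intros H. induction m as [|m IH]; simpl.
  - apply H. lia.
  - apply Rmax_lub_lt; [easy|]. apply H. lia.
Qed.

Lemma max_from_ge f n m k x :
  (n <= k <= n + m)%nat -> f k x <= max_from f n m x.
Proof.
  induction m as [|m IH]; simpl; intros H.
  - replace k with n by lia. lra.
  - destruct (Nat.eq_dec k (n + S m)) as [->|Hne].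
    + apply Rmax_r.
    + eapply Rle_trans; [apply IH; lia|apply Rmax_l].
Qed.

Lemma max_from_mono f n m n' m' x :
  (n' <= n)%nat -> (n + m <= n' + m')%nat -> max_from f n m x <= max_from f n' m' x.
Proof.
  revert n' m'. induction m as [|m IH]; simpl; intros n' m' H1 H2.
  - apply max_from_ge. lia.
  - apply Rmax_lub; [apply IH; lia|apply max_from_ge; lia].
Qed.

Lemma min_upto_le h n k x : (k <= n)%nat -> min_upto h n x <= h k x.
Proof.
  induction n as [|n IH]; simpl; intros H.
  - replace k with O by lia. lra.
  - destruct (Nat.eq_dec k (S n)) as [->|Hne]; [apply Rmin_r|].
    eapply Rle_trans; [apply Rmin_l|apply IH; lia].
Qed.

Lemma min_upto_decr h n k x : (k <= n)%nat -> min_upto h n x <= min_upto h k x.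
Proof.
  induction 1 as [|n Hn IH]; [lra|]. simpl.
  eapply Rle_trans; [apply Rmin_l|easy].
Qed.

(* Arzelà's theorem.  The maxima [h n] of long blocks of the tail have nearly
   maximal integral, so passing from [h n] to the decreasing sequence
   [min (h 0, ..., h n)] costs little area; Dini's theorem applies to the latter. *)
Lemma bounded_convergence (f : nat -> R -> R) (M : R) :
  (forall n, cont_on_R (f n)) ->
  (forall n x, 0 <= x <= 1 -> f n x <= M) ->
  (forall x, 0 <= x <= 1 -> forall eps, 0 < eps ->
     exists n0, forall n, (n0 <= n)%nat -> f n x < eps) ->
  forall eps, 0 < eps -> exists n, RInt (f n) 0 1 < eps.
Proof.
  intros Hc HM Hf eps Heps.
  (* One half pays for Dini's theorem, the other for replacing [h n] by the running minimum; the
     latter loss is [e * (1 - / 2 ^ n)], so the total stays strictly below [eps]. *)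
  pose (e := eps / 2).
  assert (He : 0 < e) by (unfold e; lra).
  (* Integrals of longer blocks starting at [n] increase and are bounded by [M]; a block nearly
     reaching their supremum can gain little by further extension. *)
  assert (Hch : forall n, exists m, forall m',
    RInt (max_from f n m') 0 1 <= RInt (max_from f n m) 0 1 + e * / 2 ^ S n).
  { intros n.
    pose proof (pow_lt 2 (S n) ltac:(lra)) as H2.
    assert (0 < e * / 2 ^ S n) by (apply Rmult_lt_0_compat; [easy|now apply Rinv_0_lt_compat]).
    destruct (completeness (fun r => exists m, r = RInt (max_from f n m) 0 1)) as (S & HS1 & HS2).
    - exists M. intros r (m & ->). apply RInt_le_bound; [now apply max_from_cont|].
      intros x Hx. apply max_from_lub. intros; now apply HM.
    - now exists (RInt (max_from f n 0) 0 1), O.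
    - apply NNPP. intros Hno.
      assert (S <= S - e * / 2 ^ Datatypes.S n); [|lra].
      apply HS2. intros r (m & ->). apply Rnot_lt_le. intros Hlt. apply Hno.
      exists m. intros m'.
      assert (RInt (max_from f n m') 0 1 <= S) by (apply HS1; now exists m'). lra. }
  pose (mm := fun n => proj1_sig (constructive_indefinite_description _ (Hch n))).
  pose (h := fun n => max_from f n (mm n)).
  assert (Hmm : forall n m', RInt (max_from f n m') 0 1 <= RInt (h n) 0 1 + e * / 2 ^ S n).
  { intros n. unfold h, mm. now destruct (constructive_indefinite_description _ (Hch n)). }
  assert (Hh : forall n, cont_on_R (h n)) by (intros n; now apply max_from_cont).
  (* Since min + max is the sum of both functions, each step adds the integral of max
     ([min_upto h n], [h (S n)]) minus that of [h n]. This maximum lies below a longer block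
     starting at [n], so the step costs at most [e * / 2 ^ S n], and the costs form a geometric
     series. *)
  assert (HD : forall n, RInt (h n) 0 1 - RInt (min_upto h n) 0 1 <= e * (1 - / 2 ^ n)).
  { induction n as [|n IH].
    - simpl. rewrite Rminus_diag. lra.
    - simpl min_upto.
      rewrite (RInt_min_max (min_upto h n) (h (S n))) by first [exact (Hh (S n)) | exact (min_upto_cont h n Hh)].
      assert (RInt (fun x => Rmax (min_upto h n x) (h (S n) x)) 0 1 <=
              RInt (max_from f n (mm n + S (mm (S n)))) 0 1).
      { apply RInt_le_cont.
        - apply cont_Rmax; [now apply (min_upto_cont h n)|apply Hh].
        - now apply max_from_cont.
        - intros x _. apply Rmax_lub.
          + eapply Rle_trans; [now apply (min_upto_le h n n)|].
            apply max_from_mono; lia.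
          + apply max_from_mono; lia. }
      pose proof (Hmm n (mm n + S (mm (S n)))%nat).
      assert (/ 2 ^ n = 2 * / 2 ^ S n) as E2.
      { simpl. rewrite Rinv_mult. pose proof (pow_lt 2 n ltac:(lra)). field. lra. }
      rewrite E2 in IH. nra. }
  (* The radius also encodes the index: [INR n + 1 <= / d] makes the common lower bound on radii a
     common upper bound on indices, and the minima decrease with the index. *)
  assert (HDini : exists n, forall x, 0 <= x <= 1 -> min_upto h n x <= e).
  { destruct (interval_gauge 0 1 (fun x d => 0 <= x <= 1 -> exists n, INR n + 1 <= / d /\
      forall y, Rabs (y - x) < d -> min_upto h n y <= e)) as (d & Hd & K).
    { intros x. destruct (excluded_middle_informative (0 <= x <= 1)) as [Hx|Hx].
      - destruct (Hf x Hx e He) as (n & Hn).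
        assert (Hlt : min_upto h n x < e).
        { eapply Rle_lt_trans; [now apply (min_upto_le h n n)|]. now apply max_from_lt. }
        destruct (cont_eps (min_upto h n) x (min_upto_cont h n Hh x) (e - min_upto h n x))
          as (d & Hd & K); [lra|].
        pose proof (pos_INR n).
        assert (0 < / (INR n + 1)) by (apply Rinv_0_lt_compat; lra).
        exists (Rmin d (/ (INR n + 1))). split; [now apply Rmin_pos|]. intros _.
        exists n. split.
        + apply Rle_trans with (/ / (INR n + 1)); [rewrite Rinv_inv; lra|]. apply Rinv_le_contravar; [now apply Rmin_pos|apply Rmin_r].
        + intros y Hy. assert (Rabs (min_upto h n y - min_upto h n x) < e - min_upto h n x) as HH.
          { apply K. eapply Rlt_le_trans; [apply Hy|apply Rmin_l]. }
          apply Rabs_def2 in HH. lra.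
      - exists 1. split; [lra|easy]. }
    destruct (INR_unbounded (/ d)) as (n & Hn).
    exists n. intros y Hy. destruct (K y Hy) as (x & d' & H1 & H2 & H3 & H4).
    destruct (H2 H1) as (k & H5 & H6).
    eapply Rle_trans; [|apply (H6 y H4)]. apply min_upto_decr.
    apply INR_le. assert (/ d' <= / d) by (now apply Rinv_le_contravar). lra. }
  destruct HDini as (n & Hn). exists n.
  assert (RInt (f n) 0 1 <= RInt (h n) 0 1).
  { apply RInt_le_cont; [easy|easy|]. intros x _. apply max_from_ge. lia. }
  assert (RInt (min_upto h n) 0 1 <= e).
  { apply RInt_le_bound; [now apply (min_upto_cont h n)|easy]. }
  specialize (HD n).
  assert (0 < / 2 ^ n) by (apply Rinv_0_lt_compat, pow_lt; lra).
  unfold e in *. nra.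
Qed.

(** This Lorentzian is a continuous cutoff: it equals 1 at [a], and its integral is of order [d].
    Multiplication by 1 minus the cutoff forces convergence at an exceptional point. *)
Lemma bump_bounds (a d : R) (x : R) : 0 < d ->
  0 < Rsqr d / (Rsqr d + Rsqr (x - a)) <= 1.
Proof.
  intros Hd. pose proof (Rle_0_sqr (x - a)).
  assert (0 < Rsqr d) by (apply Rlt_0_sqr; lra).
  split; [apply Rdiv_lt_0_compat; lra|].
  apply Rmult_le_reg_r with (Rsqr d + Rsqr (x - a)); [lra|].
  field_simplify; lra.
Qed.

(** The primitive is d atan((x - a) / d), and the arctangent varies by less than π <= 4. *)
Lemma bump_RInt (a d : R) : 0 < d ->
  RInt (fun x => Rsqr d / (Rsqr d + Rsqr (x - a))) 0 1 <= 4 * d.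
Proof.
  intros Hd.
  rewrite (is_RInt_unique _ _ _ (minus (d * atan ((1 - a) / d)) (d * atan ((0 - a) / d)))).
  - unfold minus, plus, opp; simpl.
    pose proof (atan_bound ((1 - a) / d)). pose proof (atan_bound ((0 - a) / d)).
    pose proof PI_4. nra.
  - apply (is_RInt_derive (fun x => d * atan ((x - a) / d))).
    + intros x _.
      assert (Hp : 0 < Rsqr d) by (apply Rlt_0_sqr; lra).
      pose proof (Rle_0_sqr (x - a)).
      auto_derive; [easy|]. unfold Rsqr in *. field. split; nra.
    + intros x _. apply continuity_pt_filterlim.
      pose proof (Rle_0_sqr (x - a)).
      assert (Hp : 0 < Rsqr d) by (apply Rlt_0_sqr; lra).
      reg. lra.
Qed.

Lemma bump_cont (a d : R) : 0 < d ->
  cont_on_R (fun x => Rsqr d / (Rsqr d + Rsqr (x - a))).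
Proof.
  intros Hd x. apply continuity_pt_filterlim.
  pose proof (Rle_0_sqr (x - a)).
  assert (Hp : 0 < Rsqr d) by (apply Rlt_0_sqr; lra).
  reg. lra.
Qed.

Lemma cont_mult (f g : R -> R) :
  cont_on_R f -> cont_on_R g -> cont_on_R (fun x => f x * g x).
Proof. intros Hf Hg x. apply (continuous_mult f g); [apply Hf|apply Hg]. Qed.

(** Writing φ for the cutoffs, f (1 - φ_a)(1 - φ_b) tends to 0 at every point, [a] and [b] included,
    and differs from f by at most M φ_a + M φ_b. The points may coincide or lie outside [0,1]. *)
Lemma bounded_convergence_off2 (f : nat -> R -> R) (M a b : R) :
  (forall n, cont_on_R (f n)) ->
  (forall n x, 0 <= f n x <= M) ->
  (forall x, x <> a -> x <> b -> forall eps, 0 < eps ->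
     exists n0, forall n, (n0 <= n)%nat -> f n x < eps) ->
  forall eps, 0 < eps -> exists n, RInt (f n) 0 1 < eps.
Proof.
  intros Hc HM Hf eps Heps.
  assert (HM0 : 0 <= M) by (specialize (HM O 0); lra).
  (* The two cutoffs then cost at most 8 M d <= eps / 2 together, next to the eps / 4 from the
     modified sequence. *)
  pose (d := eps / (16 * (M + 1))).
  assert (Hd : 0 < d) by (apply Rdiv_lt_0_compat; lra).
  assert (Hde : 16 * M * d <= eps).
  { replace eps with (16 * (M + 1) * d) by (unfold d; field; lra). nra. }
  pose (ph := fun c x => Rsqr d / (Rsqr d + Rsqr (x - c))).
  assert (Hph : forall c x, 0 < ph c x <= 1) by (intros; now apply bump_bounds).
  assert (Hphc : forall c, cont_on_R (ph c)) by (intros; now apply bump_cont).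
  assert (H1c : forall c, cont_on_R (fun x => 1 - ph c x)).
  { intros c x. apply (continuous_minus (V := R_NormedModule)); [apply continuous_const|apply Hphc]. }
  assert (Hph1 : forall c, ph c c = 1).
  { intros c. unfold ph. rewrite Rminus_diag, Rsqr_0, Rplus_0_r.
    apply Rdiv_diag. apply Rgt_not_eq, Rlt_0_sqr. lra. }
  destruct (bounded_convergence (fun n x => f n x * ((1 - ph a x) * (1 - ph b x))) M)
    with (eps := eps / 4) as (n & Hn).
  - intros n. apply cont_mult; [apply Hc|]. now apply cont_mult.
  - intros n x _. pose proof (HM n x). pose proof (Hph a x). pose proof (Hph b x).
    assert (0 <= (1 - ph a x) * (1 - ph b x) <= 1) by nra. nra.
  - intros x _ e He.
    destruct (Req_dec x a) as [->|Ha].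
    { exists O. intros n _. rewrite Hph1. nra. }
    destruct (Req_dec x b) as [->|Hb].
    { exists O. intros n _. rewrite Hph1. nra. }
    destruct (Hf x Ha Hb e He) as (n0 & Hn0). exists n0. intros n Hn.
    specialize (Hn0 n Hn). pose proof (HM n x). pose proof (Hph a x). pose proof (Hph b x).
    assert (0 <= (1 - ph a x) * (1 - ph b x) <= 1) by nra. nra.
  - lra.
  - exists n.
    assert (Hsc : forall c, cont_on_R (fun x => M * ph c x)).
    { intros c. apply cont_mult; [intros x; apply continuous_const|apply Hphc]. }
    assert (Hsi : forall c, RInt (fun x => M * ph c x) 0 1 <= 4 * M * d).
    { intros c. assert (RInt (fun x => M * ph c x) 0 1 = M * RInt (ph c) 0 1) as ->.
      { apply (RInt_scal (ph c) 0 1 M). now apply cont_ex_RInt. }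
      pose proof (bump_RInt c d Hd) as HH. fold (ph c) in HH. nra. }
    apply Rle_lt_trans with
      (RInt (fun x => f n x * ((1 - ph a x) * (1 - ph b x)) + (M * ph a x + M * ph b x)) 0 1).
    + apply RInt_le_cont; [apply Hc| |].
      * intros x. apply (continuous_plus (V := R_NormedModule)).
        -- apply (cont_mult (f n)); [apply Hc|]. now apply cont_mult.
        -- apply (continuous_plus (V := R_NormedModule)); apply Hsc.
      * intros x _. pose proof (HM n x). pose proof (Hph a x). pose proof (Hph b x).
        assert (0 <= (1 - ph a x) * (1 - ph b x)) by nra.
        assert (0 <= ph a x + ph b x - ph a x * ph b x <= ph a x + ph b x) by nra.
        nra.
    + rewrite (RInt_plus_cont (fun x => f n x * ((1 - ph a x) * (1 - ph b x)))
        (fun x => M * ph a x + M * ph b x)).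
      * rewrite (RInt_plus_cont (fun x => M * ph a x) (fun x => M * ph b x)) by easy.
        pose proof (Hsi a). pose proof (Hsi b). lra.
      * apply cont_mult; [apply Hc|]. now apply cont_mult.
      * intros x. apply (continuous_plus (V := R_NormedModule)); apply Hsc.
Qed.

(** * Averages along the coordinate directions *)

Definition avg {N : nat} (i : Fin.t N) (g : R -> RN N -> R) (t : R) (x : RN N) : R :=
  RInt (fun h => g t (upd x i h)) 0 1.

Definition avgs {N : nat} (l : list (Fin.t N)) (g : R -> RN N -> R) : R -> RN N -> R :=
  fold_right avg g l.

(** The derivatives are carried along as jointly continuous witnesses because averaging
    differentiates under the integral sign; the Laplacian involves pure second derivatives alone. *)
Definition subcaloric {N : nat} (v : R -> RN N -> R) : Prop :=
  exists (vt : R -> RN N -> R) (d1 d2 : Fin.t N -> R -> RN N -> R),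
    ccont v /\ ccont vt /\ (forall i, ccont (d1 i)) /\ (forall i, ccont (d2 i)) /\
    (forall t x, 0 < t -> derivable_pt_lim (fun s => v s x) t (vt t x)) /\
    (forall i t x, 0 < t -> derivable_pt_lim (fun h => v t (upd x i h)) 0 (d1 i t x)) /\
    (forall i t x, 0 < t -> derivable_pt_lim (fun h => d1 i t (upd x i h)) 0 (d2 i t x)) /\
    (forall t x, 0 < t -> vt t x <= sumFin N (fun i => d2 i t x)).

Lemma ccont_line (N : nat) (g : R -> RN N -> R) (i : Fin.t N) (t : R) (x : RN N) :
  ccont g -> 0 < t -> cont_on_R (fun h => g t (upd x i h)).
Proof.
  intros Hg Ht h. apply eps_cont. intros eps Heps.
  destruct (Hg t (upd x i h) Ht eps Heps) as (d & Hd & K).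
  exists (d / 2). split; [lra|]. intros k Hk. apply K.
  - rewrite Rminus_diag, Rabs_R0. lra.
  - intros j. replace d with (d / 2 + d / 2) by field.
    apply upd_close; [lra| |lra]. intros l. rewrite Rminus_diag, Rabs_R0. lra.
Qed.

(** A gauge on [0,1] makes the continuity of [g] uniform along the segment; both integrands are
    compared with the value at the gauge centre, at a cost of eps / 4 each. *)
Lemma avg_ccont (N : nat) (g : R -> RN N -> R) (i : Fin.t N) :
  ccont g -> ccont (avg i g).
Proof.
  intros Hg t x Ht eps Heps.
  destruct (interval_gauge 0 1 (fun h d => forall s y k,
     Rabs (s - t) < d -> (forall j, Rabs (y j - x j) < d) -> Rabs (k - h) < d ->
     Rabs (g s (upd y i k) - g t (upd x i h)) < eps / 4)) as (d & Hd & K).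
  { intros h. destruct (Hg t (upd x i h) Ht (eps / 4)) as (d & Hd & K); [lra|].
    exists (d / 2). split; [lra|]. intros s y k Hs Hy Hk. apply K; [lra|].
    intros j. replace d with (d / 2 + d / 2) by field. apply upd_close; lra || easy. }
  exists (Rmin d t). split; [now apply Rmin_pos|]. intros s y Hs Hy.
  pose proof (Rmin_l d t). pose proof (Rmin_r d t).
  assert (Hs0 : 0 < s) by (apply Rabs_def2 in Hs; lra).
  unfold avg. rewrite <- RInt_minus_cont by now apply ccont_line.
  apply Rle_lt_trans with ((1 - 0) * (eps / 2)); [|lra].
  apply abs_RInt_le_const; [lra| |].
  - apply cont_ex_RInt. intros h.
    apply (continuous_minus (V := R_NormedModule)); now apply (ccont_line N g i).
  - intros k Hk. destruct (K k Hk) as (h & e & H1 & H2 & H3 & H4).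
    assert (Rabs (g s (upd y i k) - g t (upd x i h)) < eps / 4) as E1.
    { apply H2; [lra| |easy]. intros j. specialize (Hy j). lra. }
    assert (Rabs (g t (upd x i k) - g t (upd x i h)) < eps / 4) as E2.
    { apply H2; [| |easy].
      - rewrite Rminus_diag, Rabs_R0. lra.
      - intros j. rewrite Rminus_diag, Rabs_R0. lra. }
    apply Rabs_def2 in E1. apply Rabs_def2 in E2. apply Rabs_le. lra.
Qed.

Lemma derivable_RInt_param (F dF : R -> R -> R) (x0 d : R) :
  0 < d ->
  (forall x h, Rabs (x - x0) < d -> derivable_pt_lim (fun x => F x h) x (dF x h)) ->
  (forall x, Rabs (x - x0) < d -> cont_on_R (F x)) ->
  (forall h, continuity_2d_pt dF x0 h) ->
  derivable_pt_lim (fun x => RInt (F x) 0 1) x0 (RInt (dF x0) 0 1).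
Proof.
  intros Hd HF Hc H2. apply is_derive_Reals.
  assert (HD : forall x h, Rabs (x - x0) < d -> Derive (fun x => F x h) x = dF x h).
  { intros x h Hx. apply is_derive_unique. apply is_derive_Reals. now apply HF. }
  replace (RInt (dF x0) 0 1) with (RInt (fun h => Derive (fun u => F u h) x0) 0 1).
  2:{ apply RInt_ext. intros h _. apply HD. now rewrite Rminus_diag, Rabs_R0. }
  apply (is_derive_RInt_param F 0 1 x0).
  - exists (mkposreal d Hd). intros x Hx h _. exists (dF x h).
    apply is_derive_Reals. now apply HF.
  - intros h _. apply continuity_2d_pt_ext_loc with (2 := H2 h).
    exists (mkposreal d Hd). intros u v Hu _. symmetry. now apply HD.
  - exists (mkposreal d Hd). intros x Hx. apply cont_ex_RInt. now apply Hc.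
Qed.

Lemma avg_deriv_time (N : nat) (g gt : R -> RN N -> R) (i : Fin.t N) :
  ccont g -> ccont gt ->
  (forall t x, 0 < t -> derivable_pt_lim (fun s => g s x) t (gt t x)) ->
  forall t x, 0 < t -> derivable_pt_lim (fun s => avg i g s x) t (avg i gt t x).
Proof.
  intros Hg Hgt HD t x Ht.
  assert (Hp : forall s, Rabs (s - t) < t -> 0 < s).
  { intros s Hs. apply Rabs_def2 in Hs. lra. }
  apply (derivable_RInt_param (fun s h => g s (upd x i h)) (fun s h => gt s (upd x i h)) t t Ht).
  - intros s h Hs. apply HD. now apply Hp.
  - intros s Hs. apply ccont_line; auto.
  - intros h eps. destruct (Hgt t (upd x i h) Ht eps (cond_pos eps)) as (d & Hd & K).
    assert (Hd2 : 0 < d / 2) by lra.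
    exists (mkposreal _ Hd2). simpl. intros s k Hs Hk. apply K; [lra|].
    intros j. replace d with (d / 2 + d / 2) by field.
    apply upd_close; [lra| |lra]. intros l. rewrite Rminus_diag, Rabs_R0. lra.
Qed.

(** Shifts in one direction add up, so a derivative at shift 0 from every base point is a derivative
    at every shift. *)
Lemma derivable_line (N : nat) (g dg : R -> RN N -> R) (j : Fin.t N) (t : R) :
  (forall x, derivable_pt_lim (fun h => g t (upd x j h)) 0 (dg t x)) ->
  forall x h, derivable_pt_lim (fun h => g t (upd x j h)) h (dg t (upd x j h)).
Proof.
  intros H x h eps Heps. destruct (H (upd x j h) eps Heps) as (d & K).
  exists d. intros k Hk Hkd. specialize (K k Hk Hkd).
  now rewrite !upd_add, Rplus_0_l, Rplus_0_r in K.
Qed.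

(** Shifts commute, also when [i = j], so a spatial derivative passes under the average in any
    direction. *)
Lemma avg_deriv_space (N : nat) (g dg : R -> RN N -> R) (i j : Fin.t N) :
  ccont g -> ccont dg ->
  (forall t x, 0 < t -> derivable_pt_lim (fun h => g t (upd x j h)) 0 (dg t x)) ->
  forall t x, 0 < t ->
    derivable_pt_lim (fun h => avg i g t (upd x j h)) 0 (avg i dg t x).
Proof.
  intros Hg Hdg HD t x Ht.
  replace (avg i dg t x) with (avg i dg t (upd x j 0)) by now rewrite upd_0.
  apply (derivable_RInt_param (fun s h => g t (upd (upd x j s) i h))
    (fun s h => dg t (upd (upd x j s) i h)) 0 1 Rlt_0_1).
  - intros s h _. rewrite upd_comm.
    apply (is_derive_Reals (fun s => g t (upd (upd x j s) i h))).
    apply is_derive_ext with (fun s => g t (upd (upd x i h) j s)).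
    + intros k. now rewrite upd_comm.
    + apply is_derive_Reals. apply (derivable_line N g dg). auto.
  - intros s _. now apply ccont_line.
  - intros h eps. destruct (Hdg t (upd (upd x j 0) i h) Ht eps (cond_pos eps)) as (d & Hd & K).
    assert (Hd2 : 0 < d / 4) by lra.
    exists (mkposreal _ Hd2). simpl. intros s k Hs Hk. apply K.
    + rewrite Rminus_diag, Rabs_R0. lra.
    + intros l. replace d with ((d / 2 + d / 4) + d / 4) by field.
      apply upd_close; [lra| |lra]. intros m.
      apply upd_close; [lra| |lra]. intros q. rewrite Rminus_diag, Rabs_R0. lra.
Qed.

Lemma cont_sumFin (m : nat) (h : Fin.t m -> R -> R) :
  (forall i, cont_on_R (h i)) -> cont_on_R (fun s => sumFin m (fun i => h i s)).
Proof.
  induction m as [|m IH]; simpl; intros H x; [apply continuous_const|].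
  apply (continuous_plus (V := R_NormedModule)); [apply H|].
  apply (IH (fun i => h (Fin.FS i))). intros i; apply H.
Qed.

Lemma RInt_sumFin (m : nat) (h : Fin.t m -> R -> R) :
  (forall i, cont_on_R (h i)) ->
  RInt (fun s => sumFin m (fun i => h i s)) 0 1 = sumFin m (fun i => RInt (h i) 0 1).
Proof.
  induction m as [|m IH]; simpl; intros H.
  - rewrite RInt_const. unfold scal; simpl; unfold mult; simpl. ring.
  - rewrite <- (IH (fun i => h (Fin.FS i))) by (intros i; apply H).
    apply (RInt_plus_cont (h Fin.F1) (fun s => sumFin m (fun i => h (Fin.FS i) s))).
    + apply H.
    + apply cont_sumFin. intros i; apply H.
Qed.

Lemma avg_subcaloric (N : nat) (v : R -> RN N -> R) (i : Fin.t N) :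
  subcaloric v -> subcaloric (avg i v).
Proof.
  intros (vt & d1 & d2 & H1 & H2 & H3 & H4 & H5 & H6 & H7 & H8).
  exists (avg i vt), (fun j => avg i (d1 j)), (fun j => avg i (d2 j)).
  repeat split; intros; auto using avg_ccont.
  - now apply avg_deriv_time.
  - apply avg_deriv_space; auto.
  - apply avg_deriv_space; auto.
  - unfold avg. rewrite <- (RInt_sumFin N (fun j h => d2 j t (upd x i h))).
    + apply RInt_le_cont.
      * now apply ccont_line.
      * apply cont_sumFin. intros j. now apply ccont_line.
      * intros h _. now apply H8.
    + intros j. now apply ccont_line.
Qed.

Lemma avgs_subcaloric (N : nat) (v : R -> RN N -> R) (l : list (Fin.t N)) :
  subcaloric v -> subcaloric (avgs l v).
Proof. intros H. induction l; simpl; auto using avg_subcaloric. Qed.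

Lemma avgs_ccont (N : nat) (v : R -> RN N -> R) (l : list (Fin.t N)) :
  ccont v -> ccont (avgs l v).
Proof. intros H. induction l; simpl; auto using avg_ccont. Qed.

(** * Bounds, initial traces and Lipschitz constants of averages *)

Definition bounded_by {N : nat} (M : R) (g : R -> RN N -> R) : Prop :=
  forall t x, 0 < t -> 0 <= g t x <= M.

Lemma avg_bounded (N : nat) (g : R -> RN N -> R) (i : Fin.t N) (M : R) :
  ccont g -> bounded_by M g -> bounded_by M (avg i g).
Proof.
  intros Hc Hb t x Ht. unfold avg. split.
  - apply RInt_ge_bound; [now apply ccont_line|]. intros; now apply Hb.
  - apply RInt_le_bound; [now apply ccont_line|]. intros; now apply Hb.
Qed.

Lemma avgs_bounded (N : nat) (g : R -> RN N -> R) (l : list (Fin.t N)) (M : R) :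
  ccont g -> bounded_by M g -> bounded_by M (avgs l g).
Proof.
  intros Hc Hb. induction l; simpl; [easy|]. apply avg_bounded; [now apply avgs_ccont|easy].
Qed.

(** One-sided: for a signed function the upper limit as t -> 0+ is at most 0, which is the form a
    comparison uses; for a nonnegative one this is convergence to 0. *)
Definition vanishes_at {N : nat} (g : R -> RN N -> R) (x : RN N) : Prop :=
  forall eps, 0 < eps -> exists d, 0 < d /\ forall t, 0 < t < d -> g t x < eps.

(** If the average stayed above [eps] at times [tt n] tending to 0, bounded convergence along these
    times would be contradicted; [a] and [b] are the exceptional shifts on the line through [x]. *)
Lemma avg_vanishes (N : nat) (g : R -> RN N -> R) (i : Fin.t N) (M : R) (x : RN N) (a b : R) :
  ccont g -> bounded_by M g ->
  (forall h, h <> a -> h <> b -> vanishes_at g (upd x i h)) ->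
  vanishes_at (avg i g) x.
Proof.
  intros Hc Hb Hv eps Heps. apply NNPP. intros Hno.
  assert (Hch : forall n, exists t, 0 < t < / (INR n + 1) /\ eps <= avg i g t x).
  { intros n. apply NNPP. intros Hn. apply Hno.
    exists (/ (INR n + 1)). split.
    - apply Rinv_0_lt_compat. pose proof (pos_INR n). lra.
    - intros t Ht. apply Rnot_le_lt. intros Hle. apply Hn. now exists t. }
  pose (tt := fun n => proj1_sig (constructive_indefinite_description _ (Hch n))).
  assert (Htt : forall n, 0 < tt n < / (INR n + 1) /\ eps <= avg i g (tt n) x).
  { intros n. unfold tt. now destruct (constructive_indefinite_description _ (Hch n)). }
  destruct (bounded_convergence_off2 (fun n h => g (tt n) (upd x i h)) M a b) with (eps := eps)
    as (n & Hn).
  - intros n. apply ccont_line; [easy|apply Htt].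
  - intros n h. apply Hb. apply Htt.
  - intros h Ha Hbb e He. destruct (Hv h Ha Hbb e He) as (d & Hd & K).
    destruct (INR_unbounded (/ d)) as (n0 & Hn0).
    exists n0. intros n Hn. apply K. destruct (Htt n) as [[H1 H2] _]. split; [easy|].
    eapply Rlt_trans; [apply H2|]. apply le_INR in Hn.
    rewrite <- (Rinv_inv d). apply Rinv_0_lt_compat in Hd as Hd'.
    apply Rinv_lt_contravar; [|lra]. apply Rmult_lt_0_compat; lra.
  - easy.
  - destruct (Htt n) as [_ H]. unfold avg in H. lra.
Qed.

Lemma avgs_vanishes (N : nat) (g : R -> RN N -> R) (l : list (Fin.t N)) (M : R) :
  ccont g -> bounded_by M g ->
  (forall x, vanishes_at g x) -> forall x, vanishes_at (avgs l g) x.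
Proof.
  intros Hc Hb Hv. induction l; simpl; [easy|]. intros x.
  (* No exceptional shift is left at this stage; the two zeros are placeholders. *)
  apply (avg_vanishes N _ a M x 0 0); auto using avgs_ccont, avgs_bounded.
Qed.

Definition lip_dir {N : nat} (C : R) (k : Fin.t N) (F : RN N -> R) : Prop :=
  forall x h, Rabs (F (upd x k h) - F x) <= C * Rabs h.

Lemma avg_lip_other (N : nat) (g : R -> RN N -> R) (i k : Fin.t N) (C t : R) :
  ccont g -> 0 < t -> lip_dir C k (g t) -> lip_dir C k (avg i g t).
Proof.
  intros Hc Ht Hl x h. unfold avg.
  rewrite <- RInt_minus_cont by now apply ccont_line.
  replace (C * Rabs h) with ((1 - 0) * (C * Rabs h)) by ring.
  apply abs_RInt_le_const; [lra| |].
  - apply cont_ex_RInt. intros s.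
    apply (continuous_minus (V := R_NormedModule)); now apply (ccont_line N g i).
  - intros s _. rewrite upd_comm. apply Hl.
Qed.

(** Moving the unit window by [h] changes the integral only by the two end pieces, each of length
    |h| and hence of size at most M |h|. *)
Lemma avg_lip_self (N : nat) (g : R -> RN N -> R) (i : Fin.t N) (M t : R) :
  ccont g -> bounded_by M g -> 0 < t -> lip_dir (2 * M) i (avg i g t).
Proof.
  intros Hc Hb Ht x h. unfold avg.
  pose (G := fun s => g t (upd x i s)).
  assert (HG : cont_on_R G) by now apply ccont_line.
  assert (HGb : forall s, 0 <= G s <= M) by (intros s; now apply Hb).
  assert (Hex : forall a b, ex_RInt G a b) by (intros; now apply cont_ex_RInt).
  assert (HGa : forall a b, Rabs (RInt G a b) <= M * Rabs (b - a)).
  { assert (Hle : forall a b, a <= b -> Rabs (RInt G a b) <= M * Rabs (b - a)).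
    { intros a b Hab. rewrite (Rabs_pos_eq (b - a)) by lra. rewrite Rmult_comm.
      apply abs_RInt_le_const; [easy|easy|]. intros s _. apply Rabs_le. specialize (HGb s). lra. }
    intros a b. destruct (Rle_dec a b) as [Hab|Hab]; [now apply Hle|].
    rewrite <- (opp_RInt_swap G b a) by easy.
    change (Rabs (- RInt G b a) <= M * Rabs (b - a)).
    rewrite Rabs_Ropp, Rabs_minus_sym. apply Hle. lra. }
  assert (E : RInt (fun s => g t (upd (upd x i h) i s)) 0 1 = RInt G h (1 + h)).
  { replace (RInt G h (1 + h)) with (RInt G (1 * 0 + h) (1 * 1 + h)) by (f_equal; ring).
    rewrite <- (RInt_comp_lin G 1 h 0 1) by easy.
    apply RInt_ext. intros s _. rewrite upd_add. unfold G, scal; simpl; unfold mult; simpl.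
    rewrite !Rmult_1_l. now rewrite Rplus_comm. }
  rewrite E. change (Rabs (RInt G h (1 + h) - RInt G 0 1) <= 2 * M * Rabs h).
  pose proof (RInt_Chasles G h 0 (1 + h) (Hex _ _) (Hex _ _)) as C1.
  pose proof (RInt_Chasles G 0 1 (1 + h) (Hex _ _) (Hex _ _)) as C2.
  change (RInt G h 0 + RInt G 0 (1 + h) = RInt G h (1 + h)) in C1.
  change (RInt G 0 1 + RInt G 1 (1 + h) = RInt G 0 (1 + h)) in C2.
  replace (RInt G h (1 + h) - RInt G 0 1) with (RInt G h 0 + RInt G 1 (1 + h)) by lra.
  eapply Rle_trans; [apply Rabs_triang|].
  pose proof (HGa h 0) as A1. pose proof (HGa 1 (1 + h)) as A2.
  replace (0 - h) with (- h) in A1 by ring. rewrite Rabs_Ropp in A1.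
  replace (1 + h - 1) with h in A2 by ring. lra.
Qed.

(** A direction gains its Lipschitz bound when it is averaged, and averages taken afterwards keep
    the constant. *)
Lemma avgs_lip (N : nat) (g : R -> RN N -> R) (l : list (Fin.t N)) (M t : R) (k : Fin.t N) :
  ccont g -> bounded_by M g -> 0 < t -> In k l -> lip_dir (2 * M) k (avgs l g t).
Proof.
  intros Hc Hb Ht. induction l as [|i l IH]; simpl; [easy|].
  intros [->|Hk].
  - apply avg_lip_self; auto using avgs_ccont, avgs_bounded.
  - apply avg_lip_other; auto using avgs_ccont.
Qed.

(** The coordinates are changed one at a time: the first by a shift, the others by induction with
    the first one frozen at its new value. *)
Lemma lip_sum (N : nat) (F : RN N -> R) (C : R) :
  (forall k, lip_dir C k F) ->
  forall x y, Rabs (F y - F x) <= C * sumFin N (fun i => Rabs (y i - x i)).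
Proof.
  induction N as [|n IH]; intros HF x y; simpl.
  - replace y with x.
    + rewrite Rminus_diag, Rabs_R0. lra.
    + apply functional_extensionality. intros i. pattern i; apply Fin.case0.
  - assert (E : upd x Fin.F1 (y Fin.F1 - x Fin.F1) = consR (y Fin.F1) (fun i => x (Fin.FS i))).
    { apply functional_extensionality. intros i. pattern i. apply Fin.caseS'.
      - rewrite upd_same. simpl. ring.
      - intros j. rewrite upd_diff by easy. easy. }
    pose proof (HF Fin.F1 x (y Fin.F1 - x Fin.F1)) as H1. rewrite E in H1.
    pose proof (IH (fun z => F (consR (y Fin.F1) z))) as H2.
    specialize (H2 ltac:(
      intros k z h;
      replace (consR (y Fin.F1) (upd z k h)) with (upd (consR (y Fin.F1) z) (Fin.FS k) h);
      [apply HF|];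
      apply functional_extensionality; intros i; pattern i; apply Fin.caseS';
      [now rewrite upd_diff|];
      intros j; simpl; destruct (Fin.eq_dec k j) as [<-|Hkj];
      [now rewrite !upd_same|
       rewrite !upd_diff; [easy|easy|intros E'; now apply Fin.FS_inj in E']])).
    specialize (H2 (fun i => x (Fin.FS i)) (fun i => y (Fin.FS i))). simpl in H2.
    rewrite consR_eta in H2.
    replace (F y - F x) with ((F y - F (consR (y Fin.F1) (fun i => x (Fin.FS i)))) +
      (F (consR (y Fin.F1) (fun i => x (Fin.FS i))) - F x)) by ring.
    eapply Rle_trans; [apply Rabs_triang|]. lra.
Qed.

Fixpoint all_fin (N : nat) : list (Fin.t N) :=
  match N with
  | O => nil
  | S n => Fin.F1 :: map Fin.FS (all_fin n)
  end.

Lemma in_all_fin (N : nat) (i : Fin.t N) : In i (all_fin N).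
Proof.
  induction i as [n|n i IH]; simpl; [now left|right; now apply in_map].
Qed.

(** Undoes an average: a positive value at [x], the starting point of the segment, persists on a
    piece of length [c] and makes the integral positive. *)
Lemma avg_nonpos_inv (N : nat) (g : R -> RN N -> R) (i : Fin.t N) (t : R) :
  ccont g -> 0 < t -> (forall x, 0 <= g t x) ->
  (forall x, avg i g t x <= 0) -> forall x, g t x <= 0.
Proof.
  intros Hc Ht Hp Ha x. apply Rnot_lt_le. intros Hx.
  pose proof (ccont_line N g i t x Hc Ht) as HG.
  destruct (cont_eps _ _ (HG 0) (g t x / 2)) as (d & Hd & K); [lra|].
  rewrite upd_0 in K.
  pose (c := Rmin (d / 2) 1).
  assert (Hc0 : 0 < c) by (apply Rmin_pos; lra).
  pose proof (Rmin_l (d / 2) 1). pose proof (Rmin_r (d / 2) 1). fold c in H, H0.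
  assert (Hex : forall a b, ex_RInt (fun h => g t (upd x i h)) a b) by (intros; now apply cont_ex_RInt).
  pose proof (RInt_Chasles _ 0 c 1 (Hex _ _) (Hex _ _)) as C1.
  unfold plus in C1; simpl in C1.
  assert (0 <= RInt (fun h => g t (upd x i h)) c 1).
  { apply RInt_ge_0; [lra|easy|]. intros; apply Hp. }
  assert (c * (g t x / 2) <= RInt (fun h => g t (upd x i h)) 0 c).
  { replace (c * (g t x / 2)) with (RInt (fun _ => g t x / 2) 0 c).
    - apply RInt_le; [lra|apply ex_RInt_const|easy|]. intros h Hh.
      assert (Rabs (g t (upd x i h) - g t x) < g t x / 2) as HH.
      { apply K. apply Rabs_def1; lra. }
      apply Rabs_def2 in HH. lra.
    - rewrite RInt_const. unfold scal; simpl; unfold mult; simpl. ring. }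
  specialize (Ha x). unfold avg in Ha. nra.
Qed.

Lemma avgs_nonpos_inv (N : nat) (g : R -> RN N -> R) (l : list (Fin.t N)) (M t : R) :
  ccont g -> bounded_by M g -> 0 < t ->
  (forall x, avgs l g t x <= 0) -> forall x, g t x <= 0.
Proof.
  intros Hc Hb Ht. induction l as [|i l IH]; simpl; [easy|]. intros H. apply IH.
  apply avg_nonpos_inv with i; auto using avgs_ccont.
  intros x. now apply (avgs_bounded N g l M Hc Hb).
Qed.

(** * Maximum principle *)

(** At the maximum [g1] vanishes; with [c > 0] it would be positive just to the right of 0, and the
    mean value theorem would give a larger value of [g]. *)
Lemma second_derivative_at_max (g g1 : R -> R) (c d : R) :
  (forall h, derivable_pt_lim g h (g1 h)) -> derivable_pt_lim g1 0 c ->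
  0 < d -> (forall h, Rabs h < d -> g h <= g 0) -> c <= 0.
Proof.
  intros H1 H2 Hd Hm.
  assert (E0 : g1 0 = 0).
  { pose (pr := exist (fun l => derivable_pt_abs g 0 l) (g1 0) (H1 0) : derivable_pt g 0).
    apply (deriv_maximum g (- d) d 0 pr); [lra|lra|].
    intros x Hx Hx2. apply Hm. apply Rabs_def1; lra. }
  apply Rnot_lt_le. intros Hc.
  destruct (H2 c Hc) as ([e He] & K). simpl in K.
  pose (h := Rmin d e / 2).
  assert (0 < Rmin d e) by now apply Rmin_pos.
  pose proof (Rmin_l d e). pose proof (Rmin_r d e).
  destruct (MVT_cor2 g g1 0 h) as (k & Hk1 & Hk2); [unfold h; lra|auto|].
  assert (Hg : g h <= g 0) by (apply Hm; rewrite Rabs_pos_eq; unfold h; lra).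
  assert (Hk : 0 < g1 k).
  { specialize (K k ltac:(lra)). rewrite Rabs_pos_eq in K by lra.
    specialize (K ltac:(unfold h in *; lra)). rewrite Rplus_0_l, E0, Rminus_0_r in K.
    apply Rabs_def2 in K.
    assert (0 < g1 k / k) by lra.
    replace (g1 k) with (g1 k / k * k) by (field; lra). apply Rmult_lt_0_compat; lra. }
  nra.
Qed.

(** The maximum may occur at the final time, so only earlier times are compared. *)
Lemma left_derivative_at_max (g : R -> R) (t l d : R) :
  derivable_pt_lim g t l -> 0 < d ->
  (forall s, t - d < s <= t -> g s <= g t) -> 0 <= l.
Proof.
  intros H Hd Hm. apply Rnot_lt_le. intros Hl.
  destruct (H (- l) ltac:(lra)) as ([e He] & K). simpl in K.
  assert (0 < Rmin d e) by now apply Rmin_pos.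
  pose proof (Rmin_l d e). pose proof (Rmin_r d e).
  pose (h := Rmin d e / 2).
  assert (Hh : 0 < h) by (unfold h; lra).
  specialize (K (- h) ltac:(lra)). rewrite Rabs_Ropp, Rabs_pos_eq in K by lra.
  specialize (K ltac:(unfold h; lra)). apply Rabs_def2 in K.
  assert (g (t + - h) <= g t) by (apply Hm; unfold h; lra).
  assert (0 <= (g (t + - h) - g t) / - h).
  { replace ((g (t + - h) - g t) / - h) with ((g t - g (t + - h)) / h) by (field; lra).
    apply Rdiv_le_0_compat; lra. }
  lra.
Qed.

Lemma sumFin_continuous (n : nat) (G : RN n -> Fin.t n -> R) (x : RN n) :
  (forall i eps, 0 < eps -> exists d, 0 < d /\
    forall y, (forall j, Rabs (y j - x j) < d) -> Rabs (G y i - G x i) < eps) ->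
  forall eps, 0 < eps -> exists d, 0 < d /\
    forall y, (forall j, Rabs (y j - x j) < d) ->
      Rabs (sumFin n (G y) - sumFin n (G x)) < eps.
Proof.
  (* The number [m] of summands is separated from the dimension [n], so that induction removes
     summands while the point stays in [RN n]. *)
  assert (Hgen : forall m (P : R -> RN n -> Prop) (K : RN n -> Fin.t m -> R),
    (forall d d' y, d' <= d -> P d' y -> P d y) ->
    (forall i eps, 0 < eps -> exists d, 0 < d /\
      forall y, P d y -> Rabs (K y i - K x i) < eps) ->
    forall eps, 0 < eps -> exists d, 0 < d /\
    forall y, P d y -> Rabs (sumFin m (K y) - sumFin m (K x)) < eps).
  { intros m P. induction m as [|m IH]; simpl; intros K HP HK eps Heps.
    - exists 1. split; [lra|]. intros. rewrite Rminus_diag, Rabs_R0. lra.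
    - destruct (HK Fin.F1 (eps / 2)) as (d1 & Hd1 & K1); [lra|].
      destruct (IH (fun y i => K y (Fin.FS i)) HP (fun i => HK _) (eps / 2)) as (d2 & Hd2 & K2); [lra|].
      exists (Rmin d1 d2). split; [now apply Rmin_pos|]. intros y Hy.
      specialize (K1 y (HP _ _ _ (Rmin_l _ _) Hy)).
      specialize (K2 y (HP _ _ _ (Rmin_r _ _) Hy)).
      apply Rabs_def2 in K1. apply Rabs_def2 in K2. apply Rabs_def1; lra. }
  intros H. apply (Hgen n (fun d y => forall j, Rabs (y j - x j) < d) G); [|easy].
  intros d d' y Hd Hy j. specialize (Hy j). lra.
Qed.

Lemma sqr_sum_continuous (n : nat) (x : RN n) (eps : R) : 0 < eps ->
  exists d, 0 < d /\ forall y, (forall j, Rabs (y j - x j) < d) ->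
    Rabs (sumFin n (fun j => y j * y j) - sumFin n (fun j => x j * x j)) < eps.
Proof.
  apply (sumFin_continuous n (fun y j => y j * y j)).
  intros i e He.
  destruct (cont_eps (fun r => r * r) (x i)) with (eps := e) as (d & Hd & K); [|easy|].
  - apply continuity_pt_filterlim. reg.
  - exists d. split; [easy|]. intros y Hy. apply K, Hy.
Qed.

Lemma derivable_pt_lim_ext (f g : R -> R) (x l : R) :
  (forall y, f y = g y) -> derivable_pt_lim f x l -> derivable_pt_lim g x l.
Proof.
  intros H. replace g with f; [easy|]. now apply functional_extensionality.
Qed.

(** The penalty eta (1 + |x|^2 + (2N+1) t) forces a positive maximum of [Phi] away from the initial
    slice (there v < eta) and from the lateral sides (there M <= eta r^2). At the maximum v_t >=
    (2N+1) eta while the Laplacian is at most 2N eta, which contradicts subcaloricity. *)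
Lemma maximum_principle (N : nat) (v : R -> RN N -> R) (M : R) :
  subcaloric v -> (forall t x, 0 < t -> v t x <= M) ->
  (forall r eps, 0 < eps -> exists t0, 0 < t0 /\
     forall t x, 0 < t < t0 -> (forall i, Rabs (x i) <= r) -> v t x < eps) ->
  forall t x, 0 < t -> v t x <= 0.
Proof.
  intros (vt & d1 & d2 & H1 & _ & _ & _ & H5 & H6 & H7 & H8) HM H0 T x0 HT.
  apply Rnot_lt_le. intros Hpos.
  pose (q := fun x : RN N => sumFin N (fun j => x j * x j)).
  assert (Hq : forall x, 0 <= q x) by (intros x; apply sumFin_ge0; intros; nra).
  assert (HNn := pos_INR N).
  (* [A] is the penalty at (T, x0) before scaling by [eta], so the choice of [eta] keeps [Phi]
     positive at that point. *)
  pose (A := 1 + q x0 + (2 * INR N + 1) * T).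
  assert (HA : 0 < A) by (unfold A; pose proof (Hq x0); nra).
  pose (eta := v T x0 / (2 * A)).
  assert (Heta : 0 < eta) by (apply Rdiv_lt_0_compat; lra).
  assert (HetaA : eta * A < v T x0).
  { replace (eta * A) with (v T x0 / 2) by (unfold eta; field; lra). lra. }
  pose (Phi := fun t x => v t x - eta * (1 + q x + (2 * INR N + 1) * t)).
  (* The summand [1 + q x0] places [x0] strictly inside the box; [Rabs M / eta] together with
     [1 <= r] gives M <= eta r <= eta r^2. *)
  pose (r := 1 + q x0 + Rabs M / eta).
  assert (HMe : 0 <= Rabs M / eta) by (apply Rdiv_le_0_compat; [apply Rabs_pos|easy]).
  assert (Hr1 : 1 <= r) by (pose proof (Hq x0); unfold r; lra).
  assert (HrM : M <= eta * (r * r)).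
  { apply Rle_trans with (eta * r).
    - unfold r. apply Rle_trans with (eta * (Rabs M / eta)).
      + replace (eta * (Rabs M / eta)) with (Rabs M) by (field; lra). apply Rle_abs.
      + apply Rmult_le_compat_l; [lra|]. pose proof (Hq x0). lra.
    - apply Rmult_le_compat_l; [lra|]. nra. }
  assert (Hrx : forall i, - r < x0 i < r).
  { intros i. assert (HH : x0 i * x0 i <= q x0).
    { apply (sumFin_ge_term N (fun j => x0 j * x0 j) i). intros; nra. }
    assert (1 + q x0 <= r) by (unfold r; lra).
    pose proof (Rle_0_sqr (x0 i - 1)). pose proof (Rle_0_sqr (x0 i + 1)).
    unfold Rsqr in *. lra. }
  destruct (H0 r eta Heta) as (t0 & Ht0 & K0).
  pose (t1 := Rmin (t0 / 2) T).
  assert (Ht1 : 0 < t1) by (apply Rmin_pos; lra).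
  assert (Ht1a : t1 <= t0 / 2) by apply Rmin_l.
  assert (Ht1b : t1 <= T) by apply Rmin_r.
  destruct (box_max (S N) (consR t1 (fun _ => - r)) (consR T (fun _ => r))
    (fun z => Phi (z Fin.F1) (fun i => z (Fin.FS i))) (consR T x0)) as (z & Hz & Hmax).
  - intros i. pattern i; apply Fin.caseS'; simpl; [lra|]. intros j. specialize (Hrx j). lra.
  - intros z Hz eps Heps.
    assert (Hzt : 0 < z Fin.F1) by (specialize (Hz Fin.F1); simpl in Hz; lra).
    destruct (H1 (z Fin.F1) (fun i => z (Fin.FS i)) Hzt (eps / 2)) as (e1 & He1 & K1); [lra|].
    destruct (sqr_sum_continuous N (fun i => z (Fin.FS i)) (eps / (4 * eta))) as (e2 & He2 & K2).
    { apply Rdiv_lt_0_compat; lra. }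
    pose (e3 := eps / (4 * eta * (2 * INR N + 1))).
    assert (He3 : 0 < e3).
    { apply Rdiv_lt_0_compat; [easy|]. apply Rmult_lt_0_compat; lra. }
    exists (Rmin e1 (Rmin e2 e3)). split; [repeat apply Rmin_pos; easy|].
    intros y Hy.
    pose proof (Rmin_l e1 (Rmin e2 e3)). pose proof (Rmin_r e1 (Rmin e2 e3)).
    pose proof (Rmin_l e2 e3). pose proof (Rmin_r e2 e3).
    assert (B1 : Rabs (v (y Fin.F1) (fun i => y (Fin.FS i)) -
                       v (z Fin.F1) (fun i => z (Fin.FS i))) < eps / 2).
    { apply K1; [specialize (Hy Fin.F1); lra|]. intros i; specialize (Hy (Fin.FS i)); lra. }
    assert (B2 : Rabs (q (fun i => y (Fin.FS i)) - q (fun i => z (Fin.FS i))) < eps / (4 * eta)).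
    { apply K2. intros i; specialize (Hy (Fin.FS i)); lra. }
    assert (B3 : Rabs (y Fin.F1 - z Fin.F1) < e3) by (specialize (Hy Fin.F1); lra).
    apply Rabs_def2 in B1. apply Rabs_def2 in B2. apply Rabs_def2 in B3.
    assert (C2 : eta * (eps / (4 * eta)) = eps / 4) by (field; lra).
    assert (C3 : eta * ((2 * INR N + 1) * e3) = eps / 4) by (unfold e3; field; lra).
    unfold Phi. set (a := 2 * INR N + 1) in *. set (E := eps / (4 * eta)) in *.
    assert (0 < eta * a) by (apply Rmult_lt_0_compat; unfold a; lra).
    assert (- (eta * E) < eta * (q (fun i => y (Fin.FS i)) - q (fun i => z (Fin.FS i))) < eta * E) by (split; nra).
    assert (- (eta * a * e3) < eta * a * (y Fin.F1 - z Fin.F1) < eta * a * e3) by (split; nra).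
    apply Rabs_def1; nra.
  - set (ts := z Fin.F1) in *. set (xs := fun i => z (Fin.FS i)) in *.
    assert (Hts : t1 <= ts <= T) by apply (Hz Fin.F1).
    assert (Hxs : forall i, - r <= xs i <= r) by (intros i; apply (Hz (Fin.FS i))).
    assert (Hm : forall t x, t1 <= t <= T -> (forall i, - r <= x i <= r) -> Phi t x <= Phi ts xs).
    { intros t x Ht Hx. apply (Hmax (consR t x)). intros i. pattern i; apply Fin.caseS'; simpl; auto. }
    assert (HP : 0 < Phi ts xs).
    { apply Rlt_le_trans with (Phi T x0).
      - unfold Phi. fold A. lra.
      - apply Hm; [lra|]. intros i. specialize (Hrx i). lra. }
    assert (Hts1 : t1 < ts).
    { apply Rnot_le_lt. intros Hle.
      assert (v ts xs < eta) by (apply K0; [lra|]; intros i; apply Rabs_le, Hxs).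
      unfold Phi in HP. pose proof (Hq xs). assert (0 <= (2 * INR N + 1) * ts) by nra. nra. }
    assert (Hxs1 : forall i, - r < xs i < r).
    { intros i. assert (Hn : ~ r * r <= xs i * xs i).
      { intros Hle. assert (r * r <= q xs).
        { eapply Rle_trans; [apply Hle|].
          apply (sumFin_ge_term N (fun j => xs j * xs j) i). intros; nra. }
        unfold Phi in HP. specialize (HM ts xs ltac:(lra)).
        assert (0 <= (2 * INR N + 1) * ts) by nra.
        assert (eta * (r * r) <= eta * q xs) by (apply Rmult_le_compat_l; lra). nra. }
      specialize (Hxs i). split; apply Rnot_le_lt; intros Hle; apply Hn; nra. }
    assert (Dt : 0 <= vt ts xs - eta * (2 * INR N + 1)).
    { apply (left_derivative_at_max (fun s => Phi s xs) ts _ (ts - t1)); [|lra|].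
      - apply is_derive_Reals. unfold Phi.
        apply (is_derive_minus (fun s => v s xs)).
        + apply is_derive_Reals. apply H5. lra.
        + auto_derive; [easy|ring].
      - intros s Hs. apply Hm; [lra|easy]. }
    assert (Dx : forall i, d2 i ts xs - 2 * eta <= 0).
    { intros i.
      pose (e := Rmin (r - xs i) (r + xs i)).
      assert (He : 0 < e) by (apply Rmin_pos; specialize (Hxs1 i); lra).
      apply (second_derivative_at_max (fun h => Phi ts (upd xs i h))
        (fun h => d1 i ts (upd xs i h) - 2 * eta * (xs i + h)) _ e); [| |easy|].
      - intros h.
        apply derivable_pt_lim_ext with (fun h => v ts (upd xs i h) -
          eta * (1 + (q xs + 2 * xs i * h + h * h) + (2 * INR N + 1) * ts)).
        { intros k. unfold Phi, q. now rewrite sumFin_sqr_upd. }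
        apply is_derive_Reals.
        apply (is_derive_minus (fun h => v ts (upd xs i h))).
        + apply is_derive_Reals. apply (derivable_line N v (d1 i)). intros x. apply H6. lra.
        + auto_derive; [easy|ring].
      - apply is_derive_Reals.
        apply (is_derive_minus (fun h => d1 i ts (upd xs i h))).
        + apply is_derive_Reals. apply H7. lra.
        + auto_derive; [easy|ring].
      - intros h Hh. rewrite upd_0. apply Hm; [lra|]. intros j.
        pose proof (Rmin_l (r - xs i) (r + xs i)). pose proof (Rmin_r (r - xs i) (r + xs i)).
        fold e in H, H2. apply Rabs_def2 in Hh. unfold upd.
        destruct (Fin.eq_dec i j) as [<-|]; [lra|apply Hxs]. }
    specialize (H8 ts xs ltac:(lra)).
    assert (sumFin N (fun i => d2 i ts xs) <= INR N * (2 * eta)).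
    { rewrite <- sumFin_const. apply sumFin_le. intros i. specialize (Dx i). lra. }
    nra.
Qed.

(* Averaging over unit segments in every direction keeps [v] subcaloric and makes
   it equi-Lipschitz in space; pointwise decay as [t -> 0] thus becomes locally
   uniform, as the maximum principle requires. *)
Lemma subcaloric_vanishing (n : nat) (v : R -> RN (S n) -> R) (M : R)
    (exc : RN (S n) -> Prop) :
  subcaloric v -> bounded_by M v ->
  (forall x, exists a b, forall h, exc (upd x Fin.F1 h) -> h = a \/ h = b) ->
  (forall x, ~ exc x -> vanishes_at v x) ->
  forall t x, 0 < t -> v t x <= 0.
Proof.
  intros Hs Hb He Hv t x Ht.
  assert (Hc : ccont v) by now destruct Hs as (? & ? & ? & ? & _).
  (* The average [w] removes the exceptional set: a line in direction [Fin.F1] meets it at two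
     shifts at most, so [w] vanishes initially at every point. The averages over [l] then provide
     the Lipschitz bound in all directions. *)
  pose (w := avg Fin.F1 v). pose (l := all_fin (S n)). pose (V := avgs l w).
  assert (Hwc : ccont w) by now apply avg_ccont.
  assert (Hwb : bounded_by M w) by now apply avg_bounded.
  assert (HVb : bounded_by M V) by now apply avgs_bounded.
  assert (HVv : forall y, vanishes_at V y).
  { apply avgs_vanishes with M; try easy. intros y.
    destruct (He y) as (a & b & Hab). apply avg_vanishes with M a b; try easy.
    intros h Ha Hbb. apply Hv. intros Hh. destruct (Hab h Hh); contradiction. }
  assert (HVl : forall s y z, 0 < s ->
    Rabs (V s z - V s y) <= 2 * M * sumFin (S n) (fun i => Rabs (z i - y i))).
  { intros s y z Hs0. apply lip_sum. intros k. apply avgs_lip; try easy. apply in_all_fin. }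
  assert (HM0 : 0 <= M) by (specialize (Hb 1 x Rlt_0_1); lra).
  assert (HV0 : forall s y, 0 < s -> V s y <= 0).
  { apply maximum_principle with M.
    - now apply avgs_subcaloric, avg_subcaloric.
    - intros s y Hs0. now apply HVb.
    - intros r eps Heps.
      (* Within coordinate distance [c] the Lipschitz bound allows an oscillation of at most eps /
         2; [M + 1] avoids a zero denominator. *)
      pose (c := eps / (4 * (M + 1) * INR (S n))).
      assert (HSn : 0 < INR (S n)) by (apply lt_0_INR; lia).
      assert (Hc0 : 0 < c).
      { apply Rdiv_lt_0_compat; [easy|]. apply Rmult_lt_0_compat; lra. }
      assert (Hce : 2 * M * (INR (S n) * c) <= eps / 2).
      { apply Rle_trans with (2 * (M + 1) * (INR (S n) * c)).
        - apply Rmult_le_compat_r; [|lra]. apply Rmult_le_pos; lra.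
        - apply Req_le. unfold c. field. lra. }
      (* The radius doubles as a time: [V] is small at the centre up to time [d], so the common
         lower bound on radii is a common initial time interval. *)
      destruct (box_gauge (S n) (fun _ => - r) (fun _ => r) (fun y d => d <= c /\
        forall s, 0 < s < d -> V s y < eps / 2)) as (d & Hd & K).
      { intros y. destruct (HVv y (eps / 2)) as (d & Hd & K); [lra|].
        exists (Rmin d c). split; [now apply Rmin_pos|]. split; [apply Rmin_r|].
        intros s Hs0. apply K. pose proof (Rmin_l d c). lra. }
      exists d. split; [easy|]. intros s z Hs0 Hz.
      destruct (K z) as (y & e & K1 & (K2 & K3) & K4 & K5).
      { intros i. specialize (Hz i). now apply Rabs_le_between in Hz. }
      specialize (K3 s ltac:(lra)).
      specialize (HVl s y z ltac:(lra)).
      assert (sumFin (S n) (fun i => Rabs (z i - y i)) <= INR (S n) * c).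
      { rewrite <- sumFin_const. apply sumFin_le. intros i. specialize (K5 i). lra. }
      assert (2 * M * sumFin (S n) (fun i => Rabs (z i - y i)) <= 2 * M * (INR (S n) * c)).
      { apply Rmult_le_compat_l; lra. }
      pose proof (Rle_abs (V s z - V s y)). lra. }
  revert x. apply avg_nonpos_inv with Fin.F1; try easy.
  - intros x. now apply Hb.
  - apply (avgs_nonpos_inv (S n) w l M t); try easy. intros y. now apply HV0.
Qed.

(** * Comparison *)

Lemma ccont_comp (N : nat) (phi : R -> R) (g : R -> RN N -> R) :
  ccont g -> (forall t x, 0 < t -> continuous phi (g t x)) -> ccont (fun t x => phi (g t x)).
Proof.
  intros Hg Hp t x Ht eps Heps.
  destruct (cont_eps phi (g t x) (Hp t x Ht) eps Heps) as (e & He & K1).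
  destruct (Hg t x Ht e He) as (d & Hd & K2).
  exists d. split; [easy|]. intros s y Hs Hy. apply K1. now apply K2.
Qed.

Lemma ccont_time (N : nat) : ccont (fun t (_ : RN N) => t).
Proof. intros t x _ eps Heps. now exists eps. Qed.

Lemma ccont_coord (N : nat) (i : Fin.t N) : ccont (fun _ (x : RN N) => x i).
Proof. intros t x _ eps Heps. exists eps. split; [easy|]. intros s y _ Hy. apply Hy. Qed.

Lemma ccont_const (N : nat) (c : R) : ccont (fun _ (_ : RN N) => c).
Proof.
  intros t x _ eps Heps. exists 1. split; [lra|]. intros. rewrite Rminus_diag, Rabs_R0. lra.
Qed.

Lemma ccont_plus (N : nat) (g h : R -> RN N -> R) :
  ccont g -> ccont h -> ccont (fun t x => g t x + h t x).
Proof.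
  intros Hg Hh t x Ht eps Heps.
  destruct (Hg t x Ht (eps / 2)) as (d1 & Hd1 & K1); [lra|].
  destruct (Hh t x Ht (eps / 2)) as (d2 & Hd2 & K2); [lra|].
  exists (Rmin d1 d2). split; [now apply Rmin_pos|]. intros s y Hs Hy.
  pose proof (Rmin_l d1 d2). pose proof (Rmin_r d1 d2).
  specialize (K1 s y ltac:(lra) ltac:(intros i; specialize (Hy i); lra)).
  specialize (K2 s y ltac:(lra) ltac:(intros i; specialize (Hy i); lra)).
  apply Rabs_def2 in K1. apply Rabs_def2 in K2. apply Rabs_def1; lra.
Qed.

Lemma ccont_sumFin (N m : nat) (g : Fin.t m -> R -> RN N -> R) :
  (forall i, ccont (g i)) -> ccont (fun t x => sumFin m (fun i => g i t x)).
Proof.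
  induction m as [|m IH]; simpl; intros H; [apply ccont_const|].
  apply ccont_plus; [apply H|]. apply (IH (fun i => g (Fin.FS i))). intros i; apply H.
Qed.

Lemma ccont_scal (N : nat) (c : R) (g : R -> RN N -> R) :
  ccont g -> ccont (fun t x => c * g t x).
Proof.
  intros Hg. apply (ccont_comp N (fun r => c * r)); [easy|].
  intros t x _. apply continuity_pt_filterlim. reg.
Qed.

Lemma ccont_minus (N : nat) (g h : R -> RN N -> R) :
  ccont g -> ccont h -> ccont (fun t x => g t x - h t x).
Proof.
  intros Hg Hh. apply ccont_plus; [easy|]. apply (ccont_comp N Ropp); [easy|].
  intros t x _. apply continuity_pt_filterlim. apply continuity_pt_opp, continuity_pt_id.
Qed.

Lemma ccont_mult (N : nat) (g h : R -> RN N -> R) :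
  ccont g -> ccont h -> ccont (fun t x => g t x * h t x).
Proof.
  intros Hg Hh.
  (* Polarization reduces the product to squares, that is, to composition with a function of one
     variable. *)
  replace (fun t x => g t x * h t x) with
    (fun t x => / 4 * (Rsqr (g t x + h t x) - Rsqr (g t x - h t x))).
  2:{ apply functional_extensionality; intros t; apply functional_extensionality; intros x.
      unfold Rsqr. field. }
  assert (Hs : forall r, continuous Rsqr r) by (intros r; apply continuity_pt_filterlim; reg).
  apply ccont_scal, ccont_minus; apply (ccont_comp N Rsqr); auto using ccont_plus, ccont_minus.
Qed.

Lemma derivable_pt_lim_eq (f : R -> R) (x l l' : R) :
  derivable_pt_lim f x l -> l = l' -> derivable_pt_lim f x l'.
Proof. now intros H <-. Qed.

(** An exponent of at least 2 flattens the kink at 0, where the difference quotient is at most |h|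
    for |h| < 1. The cube and the square both occur, for the first and the second derivative. *)
Lemma derivable_positive_part_pow (n : nat) (r : R) :
  derivable_pt_lim (fun r => Rmax r 0 ^ S (S n)) r (INR (S (S n)) * Rmax r 0 ^ S n).
Proof.
  destruct (Rtotal_order r 0) as [Hr|[->|Hr]].
  - rewrite Rmax_right by lra. apply is_derive_Reals.
    apply is_derive_ext_loc with (fun _ => 0).
    + assert (H : 0 < - r) by lra. exists (mkposreal _ H). intros y Hy.
      change (Rabs (y - r) < - r) in Hy. apply Rabs_def2 in Hy.
      rewrite Rmax_right by lra. simpl. ring.
    + replace (INR (S (S n)) * 0 ^ S n) with 0 by (simpl pow; ring).
      apply (is_derive_const 0 r).
  - rewrite Rmax_left by lra. intros eps Heps.
    assert (H : 0 < Rmin 1 eps) by (apply Rmin_pos; lra).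
    exists (mkposreal _ H). intros h Hh Hd. simpl in Hd.
    pose proof (Rmin_l 1 eps). pose proof (Rmin_r 1 eps).
    rewrite Rplus_0_l, (Rmax_left 0 0) by lra.
    replace ((Rmax h 0 ^ S (S n) - 0 ^ S (S n)) / h - INR (S (S n)) * 0 ^ S n)
      with (Rmax h 0 ^ S (S n) / h) by (simpl pow; field; easy).
    destruct (Rle_dec h 0) as [Hn|Hp].
    + rewrite Rmax_right by easy. replace (0 ^ S (S n) / h) with 0 by (simpl pow; field; easy).
      now rewrite Rabs_R0.
    + rewrite Rmax_left by lra. rewrite Rabs_pos_eq in Hd by lra.
      replace (h ^ S (S n) / h) with (h * h ^ n) by (simpl pow; field; easy).
      assert (0 < h ^ n <= 1).
      { split; [apply pow_lt; lra|]. rewrite <- (pow1 n). apply pow_incr. lra. }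
      rewrite Rabs_pos_eq by nra. nra.
  - rewrite Rmax_left by lra. apply is_derive_Reals.
    apply is_derive_ext_loc with (fun y => y ^ S (S n)).
    + exists (mkposreal _ Hr). intros y Hy.
      change (Rabs (y - r) < r) in Hy. apply Rabs_def2 in Hy.
      now rewrite Rmax_left by lra.
    + apply is_derive_Reals. apply (derivable_pt_lim_pow r (S (S n))).
Qed.

Lemma exp_nondecr (a b : R) : a <= b -> exp a <= exp b.
Proof. intros [H| ->]; [left; now apply exp_increasing|lra]. Qed.

(* The cube of the positive part is convex and C^2, which turns [z] into a
   classical subsolution [exp (-3 K t) * (Rmax z 0)^3] of the heat equation. *)
Lemma comparison (n : nat) (z zt : R -> RN (S n) -> R)
    (d1 d2 : Fin.t (S n) -> R -> RN (S n) -> R) (K M : R) (exc : RN (S n) -> Prop) :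
  ccont z -> ccont zt -> (forall i, ccont (d1 i)) -> (forall i, ccont (d2 i)) ->
  (forall t x, 0 < t -> derivable_pt_lim (fun s => z s x) t (zt t x)) ->
  (forall i t x, 0 < t -> derivable_pt_lim (fun h => z t (upd x i h)) 0 (d1 i t x)) ->
  (forall i t x, 0 < t -> derivable_pt_lim (fun h => d1 i t (upd x i h)) 0 (d2 i t x)) ->
  0 <= K -> (forall t x, 0 < t -> z t x <= M) ->
  (forall t x, 0 < t -> 0 < z t x -> zt t x <= sumFin (S n) (fun i => d2 i t x) + K * z t x) ->
  (forall x, exists a b, forall h, exc (upd x Fin.F1 h) -> h = a \/ h = b) ->
  (forall x, ~ exc x -> vanishes_at z x) ->
  forall t x, 0 < t -> z t x <= 0.
Proof.
  intros Hz Hzt Hd1 Hd2 Dt Dx Dxx HK HM Hsub Hexc Hv t x Ht.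
  pose (m := fun t x => Rmax (z t x) 0).
  pose (e := fun t : R => exp (- (3 * K) * t)).
  pose (v := fun t (x : RN (S n)) => e t * m t x ^ 3).
  assert (Hm0 : forall t x, 0 <= m t x) by (intros; apply Rmax_r).
  assert (He0 : forall t, 0 < e t) by (intros; apply exp_pos).
  assert (He1 : forall t, 0 < t -> e t <= 1).
  { intros s Hs. unfold e. rewrite <- exp_0. apply exp_nondecr. nra. }
  assert (Cm : ccont m).
  { apply (ccont_comp _ (fun r => Rmax r 0)); [easy|]. intros s y _.
    apply (cont_Rmax (fun r => r) (fun _ => 0)); intros r; [apply continuous_id|apply continuous_const]. }
  assert (Ce : ccont (fun t (_ : RN (S n)) => e t)).
  { apply (ccont_comp _ e); [apply ccont_time|]. intros s y _.
    apply continuity_pt_filterlim. unfold e. reg. }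
  assert (Cp : forall k, ccont (fun t x => m t x ^ k)).
  { intros k. apply (ccont_comp _ (fun r => r ^ k)); [easy|]. intros s y _.
    apply continuity_pt_filterlim. apply derivable_continuous_pt, derivable_pt_pow. }
  assert (Hvz : forall t x, 0 < t -> v t x <= 0 -> z t x <= 0).
  { intros s y Hs Hle. apply Rnot_lt_le. intros Hp.
    assert (0 < v s y); [|lra]. apply Rmult_lt_0_compat; [easy|]. apply pow_lt.
    unfold m. rewrite Rmax_left; lra. }
  apply Hvz; [easy|]. revert t x Ht.
  apply (subcaloric_vanishing n v (Rmax M 0 ^ 3) exc).
  - exists (fun t x => - (3 * K) * e t * m t x ^ 3 + e t * (3 * m t x ^ 2 * zt t x)),
      (fun i t x => e t * (3 * m t x ^ 2 * d1 i t x)),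
      (fun i t x => e t * (6 * m t x * (d1 i t x * d1 i t x) + 3 * m t x ^ 2 * d2 i t x)).
    assert (C3 : ccont (fun t x => 3 * m t x ^ 2)) by now apply ccont_scal.
    repeat split.
    + now apply ccont_mult.
    + apply ccont_plus.
      * apply ccont_mult; [now apply ccont_scal|easy].
      * apply ccont_mult; [easy|]. now apply ccont_mult.
    + intros i. apply ccont_mult; [easy|]. now apply ccont_mult.
    + intros i. apply ccont_mult; [easy|]. apply ccont_plus; apply ccont_mult; auto using ccont_scal, ccont_mult.
    + intros t x Ht. eapply derivable_pt_lim_eq.
      * apply (derivable_pt_lim_mult e (fun s => m s x ^ 3)).
        -- apply is_derive_Reals. unfold e. auto_derive; [easy|reflexivity].
        -- apply (derivable_pt_lim_comp (fun s => z s x) (fun r => Rmax r 0 ^ 3)).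
           ++ now apply Dt.
           ++ apply (derivable_positive_part_pow 1).
      * unfold e, m. simpl. ring.
    + intros i t x Ht. eapply derivable_pt_lim_eq.
      * apply (derivable_pt_lim_scal (fun h => m t (upd x i h) ^ 3) (e t)).
        apply (derivable_pt_lim_comp (fun h => z t (upd x i h)) (fun r => Rmax r 0 ^ 3)).
        -- now apply Dx.
        -- apply (derivable_positive_part_pow 1).
      * rewrite upd_0. unfold m. simpl. ring.
    + intros i t x Ht. eapply derivable_pt_lim_eq.
      * apply (derivable_pt_lim_scal (fun h => 3 * m t (upd x i h) ^ 2 * d1 i t (upd x i h)) (e t)).
        apply (derivable_pt_lim_mult (fun h => 3 * m t (upd x i h) ^ 2)).
        -- apply (derivable_pt_lim_scal (fun h => m t (upd x i h) ^ 2) 3).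
           apply (derivable_pt_lim_comp (fun h => z t (upd x i h)) (fun r => Rmax r 0 ^ 2)).
           ++ now apply Dx.
           ++ apply (derivable_positive_part_pow 0).
        -- now apply Dxx.
      * cbv beta. rewrite !upd_0. unfold m. simpl. ring.
    + intros t x Ht. rewrite sumFin_scal, sumFin_plus, sumFin_scal, sumFin_scal.
      pose proof (sumFin_ge0 _ (fun i => d1 i t x * d1 i t x) ltac:(intros; nra)) as HD.
      set (D := sumFin (S n) (fun i => d1 i t x * d1 i t x)) in *.
      pose proof (Hsub t x Ht) as HS.
      set (S2 := sumFin (S n) (fun i => d2 i t x)) in *.
      (* The term with [D] comes from convexity and is nonnegative; the factor exp (-3 K t) absorbs
         the growth 3 m^2 K z = 3 K m^3. Where z <= 0 both sides are 0, so the differential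
         inequality is used only where it is assumed. *)
      assert (3 * m t x ^ 2 * zt t x - 3 * K * m t x ^ 3 <= 6 * m t x * D + 3 * m t x ^ 2 * S2).
      { pose proof (Hm0 t x). assert (0 <= m t x * D) by now apply Rmult_le_pos.
        destruct (Rlt_dec 0 (z t x)) as [Hp|Hn].
        - specialize (HS Hp). unfold m in *. rewrite (Rmax_left (z t x) 0) in * by lra.
          assert (z t x ^ 2 * zt t x <= z t x ^ 2 * (S2 + K * z t x)).
          { apply Rmult_le_compat_l; [apply pow_le; lra|easy]. }
          replace (z t x ^ 3) with (z t x ^ 2 * z t x) by ring. lra.
        - unfold m in *. rewrite (Rmax_right (z t x) 0) in * by lra. simpl. lra. }
      specialize (He0 t).
      replace (- (3 * K) * e t * m t x ^ 3 + e t * (3 * m t x ^ 2 * zt t x)) with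
        (e t * (3 * m t x ^ 2 * zt t x - 3 * K * m t x ^ 3)) by ring.
      apply Rmult_le_compat_l; lra.
  - intros t x Ht. specialize (He0 t). specialize (He1 t Ht).
    assert (Hmp : 0 <= m t x ^ 3) by now apply pow_le.
    assert (m t x ^ 3 <= Rmax M 0 ^ 3).
    { apply pow_incr. split; [easy|]. apply Rle_max_compat_r. now apply HM. }
    unfold v. nra.
  - easy.
  - intros x Hx eps Heps.
    (* Below 1 the cube is at most the positive part itself. *)
    assert (Hmin : 0 < Rmin 1 eps) by (apply Rmin_pos; lra).
    destruct (Hv x Hx (Rmin 1 eps) Hmin) as (d & Hd & Kd).
    exists d. split; [easy|]. intros t Ht. specialize (Kd t Ht).
    pose proof (Rmin_l 1 eps). pose proof (Rmin_r 1 eps).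
    assert (Hmt : m t x < Rmin 1 eps) by (unfold m; now apply Rmax_lub_lt).
    specialize (Hm0 t x). specialize (He0 t). specialize (He1 t ltac:(lra)).
    unfold v. assert (0 <= m t x ^ 3 <= m t x).
    { split; [now apply pow_le|]. simpl.
      assert (0 <= m t x * m t x <= 1) by nra. nra. }
    nra.
Qed.

(** * The barrier *)

Definition sqn {N : nat} (x : RN N) : R := sumFin N (fun i => x i * x i).

(** The heat kernel at time t + s, scaled by (4πs)^(N/2). Writing it as one exponential makes
    derivatives and real powers immediate. *)
Definition gauss {N : nat} (s t : R) (x : RN N) : R :=
  exp (- (INR N / 2) * ln (1 + t / s) - sqn x / (4 * (t + s))).

Definition amp (s k t : R) : R := 2 - exp ((1 - k) * ln (1 + t / s)).

(* A Gaussian heat flow times an amplitude that grows from 1 to 2: the growth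
   absorbs the source term, whose size [(1 + t / s) ^ (- k)] is integrable for
   [k = N (p - 1) / 2 > 1]. *)
Definition barrier {N : nat} (c s k t : R) (x : RN N) : R := c * amp s k t * gauss s t x.

Lemma sqn_ge0 (N : nat) (x : RN N) : 0 <= sqn x.
Proof. apply sumFin_ge0. intros; nra. Qed.

Lemma one_plus_ratio (s t : R) : 0 < s -> 0 < t -> 1 < 1 + t / s.
Proof. intros Hs Ht. assert (0 < t / s) by now apply Rdiv_lt_0_compat. lra. Qed.

Lemma ln_one_plus_ge0 (s t : R) : 0 < s -> 0 < t -> 0 <= ln (1 + t / s).
Proof.
  intros Hs Ht. pose proof (one_plus_ratio s t Hs Ht).
  pose proof (ln_increasing 1 (1 + t / s) Rlt_0_1 H). rewrite ln_1 in *. lra.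
Qed.

Lemma amp_bounds (s k t : R) : 0 < s -> 1 < k -> 0 < t -> 1 <= amp s k t <= 2.
Proof.
  intros Hs Hk Ht. unfold amp. pose proof (exp_pos ((1 - k) * ln (1 + t / s))).
  assert (exp ((1 - k) * ln (1 + t / s)) <= 1); [|lra].
  apply Rle_trans with (exp 0); [|rewrite exp_0; lra]. apply exp_nondecr. pose proof (ln_one_plus_ge0 s t Hs Ht). nra.
Qed.

Lemma gauss_le (N : nat) (s t : R) (x : RN N) : 0 < s -> 0 < t ->
  gauss s t x <= exp (- (INR N / 2) * ln (1 + t / s)).
Proof.
  intros Hs Ht. apply exp_nondecr.
  assert (0 <= sqn x / (4 * (t + s))) by (apply Rdiv_le_0_compat; [apply sqn_ge0|lra]). lra.
Qed.

Lemma gauss_le_1 (N : nat) (s t : R) (x : RN N) : 0 < s -> 0 < t -> gauss s t x <= 1.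
Proof.
  intros Hs Ht. eapply Rle_trans; [now apply gauss_le|].
  apply Rle_trans with (exp 0); [|rewrite exp_0; lra]. apply exp_nondecr.
  pose proof (ln_one_plus_ge0 s t Hs Ht). pose proof (pos_INR N). nra.
Qed.

(** The first term stems from the growing amplitude and is the surplus that dominates the source;
    the second stems from the Gaussian and equals the Laplacian. *)
Definition barrier_t {N : nat} (c s k t : R) (x : RN N) : R :=
  c * ((k - 1) / s * exp (- k * ln (1 + t / s))) * gauss s t x +
  barrier c s k t x * (- (INR N / 2) / (t + s) + sqn x / (4 * ((t + s) * (t + s)))).

Definition barrier_x {N : nat} (c s k : R) (i : Fin.t N) (t : R) (x : RN N) : R :=
  barrier c s k t x * (- (/ (2 * (t + s)) * x i)).

Definition barrier_xx {N : nat} (c s k : R) (i : Fin.t N) (t : R) (x : RN N) : R :=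
  barrier c s k t x * (/ (4 * ((t + s) * (t + s))) * (x i * x i) + - / (2 * (t + s))).

Lemma barrier_deriv_t (N : nat) (c s k t : R) (x : RN N) : 0 < s -> 0 < t ->
  derivable_pt_lim (fun r => barrier c s k r x) t (barrier_t c s k t x).
Proof.
  intros Hs Ht. pose proof (one_plus_ratio s t Hs Ht).
  assert (0 < (t + s)) by lra.
  apply is_derive_Reals. unfold barrier_t, barrier, amp, gauss. auto_derive.
  - repeat split; lra.
  (* Differentiating (1+t/s)^(1-k) leaves a factor 1/(1+t/s), which lowers the exponent to -k. *)
  - assert (E : exp ((1 + - k) * ln (1 + t * / s)) = exp (- k * ln (1 + t * / s)) * ((t + s) * / s)).
    { replace ((t + s) * / s) with (exp (ln (1 + t * / s))).
      - rewrite <- exp_plus. f_equal. ring.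
      - unfold Rdiv in *. rewrite exp_ln by lra. field. lra. }
    unfold Rminus, Rdiv. rewrite E. field. lra.
Qed.

Lemma gauss_upd (N : nat) (s t h : R) (x : RN N) (i : Fin.t N) :
  gauss s t (upd x i h) =
  exp (- (INR N / 2) * ln (1 + t / s) - (sqn x + 2 * x i * h + h * h) / (4 * (t + s))).
Proof. unfold gauss, sqn. now rewrite sumFin_sqr_upd. Qed.

Lemma barrier_deriv_x (N : nat) (c s k : R) (i : Fin.t N) (t : R) (x : RN N) : 0 < s -> 0 < t ->
  derivable_pt_lim (fun h => barrier c s k t (upd x i h)) 0 (barrier_x c s k i t x).
Proof.
  intros Hs Ht. apply is_derive_Reals. unfold barrier_x, barrier.
  apply is_derive_ext with (fun h => c * amp s k t *
    exp (- (INR N / 2) * ln (1 + t / s) - (sqn x + 2 * x i * h + h * h) / (4 * (t + s)))).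
  { intros h. now rewrite gauss_upd. }
  unfold gauss. auto_derive; [easy|].
  replace (sqn x + 2 * x i * 0 + 0 * 0) with (sqn x) by ring.
  unfold Rminus, Rdiv. field. lra.
Qed.

Lemma barrier_deriv_xx (N : nat) (c s k : R) (i : Fin.t N) (t : R) (x : RN N) : 0 < s -> 0 < t ->
  derivable_pt_lim (fun h => barrier_x c s k i t (upd x i h)) 0 (barrier_xx c s k i t x).
Proof.
  intros Hs Ht. apply is_derive_Reals. unfold barrier_x, barrier_xx, barrier.
  apply is_derive_ext with (fun h => c * amp s k t *
    exp (- (INR N / 2) * ln (1 + t / s) - (sqn x + 2 * x i * h + h * h) / (4 * (t + s))) *
    (- (/ (2 * (t + s)) * (x i + h)))).
  { intros h. now rewrite gauss_upd, upd_same. }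
  unfold gauss. auto_derive; [easy|].
  replace (sqn x + 2 * x i * 0 + 0 * 0) with (sqn x) by ring.
  unfold Rminus, Rdiv. field. lra.
Qed.

Lemma barrier_laplacian (N : nat) (c s k t : R) (x : RN N) : 0 < s -> 0 < t ->
  sumFin N (fun i => barrier_xx c s k i t x) =
  barrier c s k t x * (- (INR N / 2) / (t + s) + sqn x / (4 * ((t + s) * (t + s)))).
Proof.
  intros Hs Ht. unfold barrier_xx. rewrite sumFin_scal, sumFin_plus, sumFin_scal, sumFin_const.
  fold (sqn x). f_equal. field. lra.
Qed.

Lemma ccont_of_time (N : nat) (phi : R -> R) :
  (forall t, 0 < t -> ex_derive phi t) -> ccont (fun t (_ : RN N) => phi t).
Proof.
  intros H. apply (ccont_comp N phi); [apply ccont_time|].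
  intros t _ Ht. apply (ex_derive_continuous phi). now apply H.
Qed.

Lemma ccont_sqn (N : nat) : ccont (fun _ (x : RN N) => sqn x).
Proof.
  apply (ccont_sumFin N N (fun i _ x => x i * x i)). intros i.
  apply ccont_mult; apply ccont_coord.
Qed.

Lemma ccont_gauss (N : nat) (s : R) : 0 < s -> ccont (fun t (x : RN N) => gauss s t x).
Proof.
  intros Hs. apply (ccont_comp N exp).
  - apply ccont_minus.
    + apply ccont_of_time. intros t Ht. pose proof (one_plus_ratio s t Hs Ht).
      auto_derive. lra.
    + apply ccont_mult; [apply ccont_sqn|].
      apply (ccont_of_time N (fun t => / (4 * (t + s)))). intros t Ht. auto_derive. lra.
  - intros t x _. apply (ex_derive_continuous exp). auto_derive. easy.
Qed.

Lemma ccont_barrier (N : nat) (c s k : R) : 0 < s -> ccont (fun t (x : RN N) => barrier c s k t x).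
Proof.
  intros Hs. apply ccont_mult; [|now apply ccont_gauss].
  apply ccont_of_time. intros t Ht. pose proof (one_plus_ratio s t Hs Ht).
  unfold amp. auto_derive. lra.
Qed.

Lemma ccont_barrier_t (N : nat) (c s k : R) : 0 < s -> ccont (@barrier_t N c s k).
Proof.
  intros Hs. apply ccont_plus; apply ccont_mult; [|now apply ccont_gauss|now apply ccont_barrier|].
  - apply ccont_of_time. intros t Ht. pose proof (one_plus_ratio s t Hs Ht). auto_derive. lra.
  - apply ccont_plus.
    + apply ccont_of_time. intros t Ht. auto_derive. lra.
    + apply ccont_mult; [apply ccont_sqn|].
      apply (ccont_of_time N (fun t => / (4 * ((t + s) * (t + s))))). intros t Ht. auto_derive. nra.
Qed.

Lemma ccont_barrier_x (N : nat) (c s k : R) (i : Fin.t N) : 0 < s -> ccont (barrier_x c s k i).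
Proof.
  intros Hs. apply ccont_mult; [now apply ccont_barrier|]. apply (ccont_comp N Ropp).
  - apply ccont_mult; [|apply ccont_coord].
    apply ccont_of_time. intros t Ht. auto_derive. lra.
  - intros t x _. apply (ex_derive_continuous Ropp). auto_derive. easy.
Qed.

Lemma ccont_barrier_xx (N : nat) (c s k : R) (i : Fin.t N) : 0 < s -> ccont (barrier_xx c s k i).
Proof.
  intros Hs. apply ccont_mult; [now apply ccont_barrier|]. apply ccont_plus.
  - apply ccont_mult; [|apply ccont_mult; apply ccont_coord].
    apply ccont_of_time. intros t Ht. auto_derive. nra.
  - apply ccont_of_time. intros t Ht. auto_derive. lra.
Qed.

(** * Power bound on the nonlinearity; comparison with zero and with the barrier *)

Lemma reaction_le_power (f : R -> R) (p : R) : assumption_M f p ->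
  exists C, 0 < C /\ forall u, 0 < u -> f u <= C * Rpower u p.
Proof.
  intros (Hlip & _ & H1 & _ & Hp & c1 & c2 & d & _ & Hc2 & Hd & Hf).
  destruct (Hlip 0 1) as (K & HK).
  assert (HP : forall u, 0 < Rpower u p) by (intros u; apply exp_pos).
  (* Below [d] the constant [c2] serves; on [d,1) the Lipschitz bound with f(1) = 0 gives f <= |K|,
     while u^p >= d^p; from 1 on f vanishes. *)
  exists (c2 + Rabs K / Rpower d p).
  assert (0 <= Rabs K / Rpower d p) by (apply Rdiv_le_0_compat; [apply Rabs_pos|apply HP]).
  split; [lra|]. intros u Hu. specialize (HP u) as HPu.
  destruct (Rlt_dec u d) as [Hud|Hud].
  { destruct (Hf u) as [_ HH]; [lra|]. nra. }
  destruct (Rlt_dec u 1) as [Hu1|Hu1].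
  - specialize (HK u 1 ltac:(lra) ltac:(lra)). rewrite (H1 1) in HK by lra.
    rewrite Rminus_0_r in HK.
    assert (f u <= Rabs K).
    { pose proof (Rle_abs (f u)). pose proof (Rle_abs K). pose proof (Rabs_pos K).
      assert (Rabs (u - 1) <= 1) by (apply Rabs_le; lra).
      pose proof (Rabs_pos (u - 1)). nra. }
    assert (Rpower d p <= Rpower u p) by (apply Rle_Rpower_l; lra).
    assert (Rabs K <= Rabs K / Rpower d p * Rpower u p).
    { apply Rle_trans with (Rabs K / Rpower d p * Rpower d p).
      - apply Req_le. field. specialize (HP d). lra.
      - now apply Rmult_le_compat_l. }
    nra.
  - rewrite H1 by lra. nra.
Qed.

Lemma sphere_line (n : nat) (L : R) (x : RN (S n)) : 0 < L ->
  exists a b, forall h, normN (upd x Fin.F1 h) = L -> h = a \/ h = b.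
Proof.
  (* The sphere equation reads (h + x_1)^2 = c; for c < 0 no shift satisfies it and the two
     witnesses are vacuous. *)
  intros HL. pose (c := L * L - sqn x + x Fin.F1 * x Fin.F1).
  exists (sqrt c - x Fin.F1), (- sqrt c - x Fin.F1). intros h Hh.
  unfold normN in Hh. rewrite sumFin_sqr_upd in Hh. fold (sqn x) in Hh.
  assert (E : sqn x + 2 * x Fin.F1 * h + h * h = L * L).
  { rewrite <- Hh. symmetry. apply sqrt_sqrt.
    pose proof (sqn_ge0 (S n) (upd x Fin.F1 h)) as HH. unfold sqn in HH.
    now rewrite sumFin_sqr_upd in HH. }
  assert (Ec : c = (h + x Fin.F1) * (h + x Fin.F1)) by (unfold c; lra).
  assert (Es : sqrt c * sqrt c = c) by (apply sqrt_sqrt; rewrite Ec; apply Rle_0_sqr).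
  assert ((h + x Fin.F1 - sqrt c) * (h + x Fin.F1 + sqrt c) = 0) as E0.
  { transitivity ((h + x Fin.F1) * (h + x Fin.F1) - sqrt c * sqrt c); [ring|lra]. }
  destruct (Rmult_integral _ _ E0); [left|right]; lra.
Qed.

(** The two terms of the exponent cost at most 1/4 each, and exp y >= 1 + y gives 1/2. *)
Lemma gauss_initial (N : nat) (s t : R) (x : RN N) :
  0 < s -> sqn x <= s -> 0 < t -> INR N * t <= s / 2 -> / 2 <= gauss s t x.
Proof.
  intros Hs Hx Ht HN.
  pose proof (one_plus_ratio s t Hs Ht).
  assert (Hl : ln (1 + t / s) <= t / s).
  { rewrite <- (ln_exp (t / s)) at 2. apply Rcomplements.ln_le; [lra|apply exp_ineq1_le]. }
  assert (H1 : INR N / 2 * (t / s) <= / 4).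
  { apply Rmult_le_reg_r with s; [easy|].
    replace (INR N / 2 * (t / s) * s) with (INR N * t / 2) by (field; lra). lra. }
  assert (H2 : sqn x / (4 * (t + s)) <= / 4).
  { apply Rmult_le_reg_r with (4 * (t + s)); [lra|].
    replace (sqn x / (4 * (t + s)) * (4 * (t + s))) with (sqn x) by (field; lra). lra. }
  pose proof (pos_INR N).
  assert (INR N / 2 * ln (1 + t / s) <= INR N / 2 * (t / s)) by (apply Rmult_le_compat_l; lra).
  eapply Rle_trans; [|apply exp_ineq1_le]. lra.
Qed.

Lemma barrier_supersolution (N : nat) (f : R -> R) (p C e L k : R) :
  0 < C -> (forall u, 0 < u -> f u <= C * Rpower u p) ->
  1 < p -> 0 < e -> 0 < L -> 1 < k -> k = INR N * (p - 1) / 2 ->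
  L * L <= (k - 1) / (2 * C * Rpower (4 * e) (p - 1)) ->
  forall t (x : RN N), 0 < t ->
    sumFin N (fun i => barrier_xx (2 * e) (L * L) k i t x) +
    f (barrier (2 * e) (L * L) k t x) <= barrier_t (2 * e) (L * L) k t x.
Proof.
  intros HC Hf Hp He HL Hk Ek HLe t x Ht.
  set (s := L * L) in *. assert (Hs : 0 < s) by (unfold s; nra).
  rewrite barrier_laplacian by easy. unfold barrier_t.
  set (Q := - (INR N / 2) / (t + s) + sqn x / (4 * ((t + s) * (t + s)))).
  set (G := gauss s t x). set (E := exp (- k * ln (1 + t / s))).
  assert (HG : 0 < G) by apply exp_pos.
  assert (HE : 0 < E) by apply exp_pos.
  pose proof (amp_bounds s k t Hs Hk Ht) as HA.
  assert (HW : 0 < barrier (2 * e) s k t x).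
  { unfold barrier. fold G. repeat apply Rmult_lt_0_compat; lra. }
  assert (HW4 : barrier (2 * e) s k t x <= 4 * e * G).
  { unfold barrier. fold G. apply Rmult_le_compat_r; [lra|]. nra. }
  set (P := Rpower (4 * e) (p - 1)) in *.
  assert (HP : 0 < P) by apply exp_pos.
  (* This is where k = N (p - 1) / 2 enters: raising (1+t/s)^(-N/2) to the power p - 1 gives the
     decay rate of the amplitude's derivative. *)
  assert (HGE : Rpower G (p - 1) <= E).
  { apply exp_nondecr. unfold G, gauss. rewrite ln_exp.
    assert (0 <= sqn x / (4 * (t + s))) by (apply Rdiv_le_0_compat; [apply sqn_ge0|lra]).
    rewrite Ek. nra. }
  assert (Hpow : Rpower (barrier (2 * e) s k t x) p <= 4 * e * G * (P * E)).
  { eapply Rle_trans; [apply Rle_Rpower_l; [lra|split; [exact HW|exact HW4]]|].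
    replace p with (1 + (p - 1)) at 1 by ring.
    assert (0 < 4 * e * G) by (repeat apply Rmult_lt_0_compat; lra).
    rewrite Rpower_plus, Rpower_1 by easy.
    apply Rmult_le_compat_l; [lra|].
    rewrite <- Rpower_mult_distr by lra. fold P. apply Rmult_le_compat_l; lra. }
  assert (Hks : 2 * C * P <= (k - 1) / s).
  { apply Rmult_le_reg_r with s; [easy|].
    replace ((k - 1) / s * s) with (k - 1) by (field; lra).
    apply Rmult_le_compat_r with (r := 2 * C * P) in HLe; [|nra].
    replace ((k - 1) / (2 * C * P) * (2 * C * P)) with (k - 1) in HLe by (field; lra). lra. }
  specialize (Hf _ HW).
  assert (C * Rpower (barrier (2 * e) s k t x) p <= 2 * e * ((k - 1) / s * E) * G).
  { apply Rle_trans with (C * (4 * e * G * (P * E))).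
    - apply Rmult_le_compat_l; lra.
    - replace (C * (4 * e * G * (P * E))) with (2 * e * (2 * C * P * E) * G) by ring.
      apply Rmult_le_compat_r; [lra|]. apply Rmult_le_compat_l; [lra|].
      apply Rmult_le_compat_r; lra. }
  lra.
Qed.

Lemma sqn_normN (N : nat) (x : RN N) : normN x * normN x = sqn x.
Proof. apply sqrt_sqrt, sqn_ge0. Qed.

Lemma ball_ind_bounds (N : nat) (L : R) (x : RN N) : 0 <= ball_ind L x <= 1.
Proof. unfold ball_ind. destruct (Rlt_dec (normN x) L); lra. Qed.

(** Where u < 0 the source vanishes, so -u solves the heat equation there and comparison applies
    with [K = 0]. *)
Lemma classical_solution_ge0 (n : nat) (f : R -> R) (e L : R)
    (u : R -> RN (S n) -> R) :
  (forall r, r <= 0 -> f r = 0) -> 0 < e -> 0 < L ->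
  classical_solution f (fun x => e * ball_ind L x) (fun x => normN x = L) u ->
  forall t x, 0 < t -> 0 <= u t x.
Proof.
  intros Hf He HL ((M & HM) & ut & d1 & d2 & Cu & Cut & Cd1 & Cd2 & Dt & Dx & Dxx & Heq & Hini) t x Ht.
  assert (Copp : forall g : R -> RN (S n) -> R, cont_pos g -> ccont (fun t x => - g t x)).
  { intros g Hg. apply (ccont_comp _ Ropp); [now apply cont_pos_ccont|].
    intros s y _. apply (ex_derive_continuous Ropp). auto_derive. easy. }
  assert (- u t x <= 0); [|lra]. revert t x Ht.
  apply (comparison n (fun t x => - u t x) (fun t x => - ut t x) (fun i t x => - d1 i t x)
    (fun i t x => - d2 i i t x) 0 M (fun x => normN x = L)); auto.
  - intros t x Ht. now apply (derivable_pt_lim_opp (fun s => u s x)), Dt.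
  - intros i t x Ht. now apply (derivable_pt_lim_opp (fun h => u t (upd x i h))), Dx.
  - intros i t x Ht. now apply (derivable_pt_lim_opp (fun h => d1 i t (upd x i h))), Dxx.
  - lra.
  - intros t x Ht. specialize (HM t x Ht). apply Rabs_le_between in HM. lra.
  - intros t x Ht Hp. rewrite (Heq t x Ht), Hf by lra.
    rewrite (sumFin_ext _ (fun i => - d2 i i t x) (fun i => -1 * d2 i i t x)) by (intros; ring).
    rewrite sumFin_scal. lra.
  - intros x. now apply sphere_line.
  - intros x Hx eps Heps. destruct (Hini x Hx eps Heps) as (d & Hd & K).
    exists d. split; [easy|]. intros t Ht. specialize (K t Ht).
    pose proof (ball_ind_bounds _ L x). apply Rabs_def2 in K. nra.
Qed.

(** Comparison is applied to u - W. Off the sphere the initial order holds because W >= e inside the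
    ball for short times and W > 0 outside. *)
Lemma classical_solution_le_barrier (n : nat) (f : R -> R) (p C e L k : R)
    (u : R -> RN (S n) -> R) :
  locally_lipschitz f -> 0 < C -> (forall r, 0 < r -> f r <= C * Rpower r p) ->
  1 < p -> 0 < e -> 0 < L -> 1 < k -> k = INR (S n) * (p - 1) / 2 ->
  L * L <= (k - 1) / (2 * C * Rpower (4 * e) (p - 1)) ->
  classical_solution f (fun x => e * ball_ind L x) (fun x => normN x = L) u ->
  forall t x, 0 < t -> u t x <= barrier (2 * e) (L * L) k t x.
Proof.
  intros Hlip HC Hf Hp He HL Hk Ek HLe
    ((M & HM) & ut & d1 & d2 & Cu & Cut & Cd1 & Cd2 & Dt & Dx & Dxx & Heq & Hini) t x Ht.
  set (s := L * L) in *. assert (Hs : 0 < s) by (unfold s; nra).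
  set (W := barrier (N := S n) (2 * e) s k).
  assert (HW : forall t x, 0 < t -> 2 * e * gauss s t x <= W t x <= 4 * e).
  { intros r y Hr. unfold W, barrier.
    pose proof (amp_bounds s k r Hs Hk Hr). pose proof (gauss_le_1 _ s r y Hs Hr).
    assert (0 < gauss s r y) by apply exp_pos.
    assert (gauss s r y <= amp s k r * gauss s r y <= 2) by nra. nra. }
  assert (HW0 : forall t x, 0 < t -> 0 < W t x).
  { intros r y Hr. specialize (HW r y Hr). assert (0 < gauss s r y) by apply exp_pos. nra. }
  (* This interval contains all values of both u and W; since the sign of the Lipschitz constant is
     not prescribed, [Rabs K] is passed on. *)
  destruct (Hlip (- (Rabs M + 4 * e)) (Rabs M + 4 * e)) as (K & HK).
  pose proof (Rle_abs M) as HMa.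
  assert (u t x - W t x <= 0); [|lra]. revert t x Ht.
  apply (comparison n (fun t x => u t x - W t x) (fun t x => ut t x - barrier_t (2 * e) s k t x)
    (fun i t x => d1 i t x - barrier_x (2 * e) s k i t x)
    (fun i t x => d2 i i t x - barrier_xx (2 * e) s k i t x) (Rabs K) M (fun x => normN x = L)).
  - apply ccont_minus; [now apply cont_pos_ccont|now apply ccont_barrier].
  - apply ccont_minus; [now apply cont_pos_ccont|now apply ccont_barrier_t].
  - intros i. apply ccont_minus; [now apply cont_pos_ccont|now apply ccont_barrier_x].
  - intros i. apply ccont_minus; [now apply cont_pos_ccont|now apply ccont_barrier_xx].
  - intros t x Ht. apply (derivable_pt_lim_minus (fun r => u r x)); [now apply Dt|].
    now apply barrier_deriv_t.
  - intros i t x Ht. apply (derivable_pt_lim_minus (fun h => u t (upd x i h))); [now apply Dx|].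
    now apply barrier_deriv_x.
  - intros i t x Ht. apply (derivable_pt_lim_minus (fun h => d1 i t (upd x i h))); [now apply Dxx|].
    now apply barrier_deriv_xx.
  - apply Rabs_pos.
  - intros t x Ht. specialize (HM t x Ht). apply Rabs_le_between in HM.
    specialize (HW0 t x Ht). lra.
  - intros t x Ht Hz. rewrite (Heq t x Ht).
    rewrite (sumFin_ext _ (fun i => d2 i i t x - barrier_xx (2 * e) s k i t x)
      (fun i => d2 i i t x + -1 * barrier_xx (2 * e) s k i t x)) by (intros; ring).
    rewrite sumFin_plus, sumFin_scal.
    pose proof (barrier_supersolution (S n) f p C e L k HC Hf Hp He HL Hk Ek HLe t x Ht) as Hsup.
    fold s in Hsup. fold W in Hsup.
    specialize (HM t x Ht). apply Rabs_le_between in HM.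
    specialize (HW t x Ht). specialize (HW0 t x Ht).
    specialize (HK (u t x) (W t x) ltac:(lra) ltac:(lra)).
    rewrite (Rabs_pos_eq (u t x - W t x)) in HK by lra.
    pose proof (Rle_abs (f (u t x) - f (W t x))). pose proof (Rle_abs K).
    assert (K * (u t x - W t x) <= Rabs K * (u t x - W t x)) by (apply Rmult_le_compat_r; lra).
    lra.
  - intros x. now apply sphere_line.
  - intros x Hx eps Heps. destruct (Hini x Hx eps Heps) as (d & Hd & Kd).
    unfold ball_ind in Kd. destruct (Rlt_dec (normN x) L) as [HxL|HxL].
    (* Up to this time N t <= s / 2, as the lower bound on the Gaussian requires. *)
    + pose (d' := s / (2 * INR (S n))).
      assert (HSn : 0 < INR (S n)) by (apply lt_0_INR; lia).
      assert (Hd' : 0 < d') by (apply Rdiv_lt_0_compat; lra).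
      exists (Rmin d d'). split; [now apply Rmin_pos|]. intros t Ht.
      pose proof (Rmin_l d d'). pose proof (Rmin_r d d').
      specialize (Kd t ltac:(lra)). apply Rabs_def2 in Kd.
      assert (/ 2 <= gauss s t x).
      { apply gauss_initial; [easy| |lra|].
        - rewrite <- sqn_normN. pose proof (sqrt_pos (sumFin _ (fun i => x i * x i))) as Hn.
          fold (normN x) in Hn. unfold s. nra.
        - apply Rle_trans with (INR (S n) * d'); [apply Rmult_le_compat_l; lra|].
          apply Req_le. unfold d'. field. lra. }
      specialize (HW t x ltac:(lra)). nra.
    + exists d. split; [easy|]. intros t Ht. specialize (Kd t Ht). apply Rabs_def2 in Kd.
      specialize (HW0 t x ltac:(lra)). lra.
Qed.

(** * The constant in the smallness condition and the decay rate *)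

Theorem theorem6p2 :
  forall (f : R -> R) (N : nat) (p : R),
    (0 < N)%nat ->
    assumption_M f p ->
    p > 1 + 2 / INR N ->
    exists Cm : R, 0 < Cm /\
      forall (eps L : R), 0 < eps <= 1 -> 0 < L ->
        L < Cm * Rpower eps (- ((p - 1) / 2)) ->
        forall u : R -> RN N -> R,
          classical_solution f (fun x => eps * ball_ind L x)
                               (fun x => normN x = L) u ->
          exists K T : R, 0 < T /\
            forall t x, T <= t -> Rabs (u t x) <= K * Rpower t (- (INR N / 2)).
Proof.
  intros f N p HN HM Hp.
  destruct N as [|n]; [lia|].
  destruct (reaction_le_power f p HM) as (C & HC & HfC).
  destruct HM as (Hlip & Hf0 & _ & _ & Hp1 & _).
  assert (HNr : 0 < INR (S n)) by (apply lt_0_INR; lia).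
  pose (k := INR (S n) * (p - 1) / 2).
  assert (Hk : 1 < k).
  { assert (2 / INR (S n) * INR (S n) < (p - 1) * INR (S n)) as HH.
    { apply Rmult_lt_compat_r; lra. }
    replace (2 / INR (S n) * INR (S n)) with 2 in HH by (field; lra). unfold k. lra. }
  assert (HP4 : 0 < Rpower 4 (p - 1)) by apply exp_pos.
  (* The part of the bound on L^2 that is free of eps, obtained by splitting (4 eps)^(p-1); its
     square root is the constant for [L]. *)
  pose (A := (k - 1) / (2 * C * Rpower 4 (p - 1))).
  assert (HA : 0 < A).
  { apply Rdiv_lt_0_compat; [lra|]. apply Rmult_lt_0_compat; lra. }
  exists (sqrt A). split; [now apply sqrt_lt_R0|].
  intros e L [He He1] HL HLe u Hu.
  assert (HL2 : L * L <= (k - 1) / (2 * C * Rpower (4 * e) (p - 1))).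
  { set (r := Rpower e (- ((p - 1) / 2))) in *.
    assert (Hr : 0 < r) by apply exp_pos.
    assert (Hrr : r * r = / Rpower e (p - 1)).
    { unfold r. rewrite <- Rpower_plus, <- Rpower_Ropp. f_equal. field. }
    assert (HPe : 0 < Rpower e (p - 1)) by apply exp_pos.
    rewrite <- Rpower_mult_distr by lra.
    replace ((k - 1) / (2 * C * (Rpower 4 (p - 1) * Rpower e (p - 1)))) with (A * (r * r)).
    - pose proof (sqrt_sqrt A ltac:(lra)) as HsA. rewrite <- HsA.
      replace (sqrt A * sqrt A * (r * r)) with ((sqrt A * r) * (sqrt A * r)) by ring.
      apply Rmult_le_compat; lra.
    - rewrite Hrr. unfold A. field. repeat split; lra. }
  (* The exponential is L^N: 1 + t/s >= t/s gives (1+t/s)^(-N/2) <= s^(N/2) t^(-N/2) with s = L^2,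
     and 4 e bounds the amplitude. The barrier bound holds for all t > 0, so T = 1 is an arbitrary
     choice. *)
  exists (4 * e * exp (INR (S n) / 2 * ln (L * L))), 1. split; [lra|].
  intros t x Ht.
  pose proof (classical_solution_ge0 n f e L u Hf0 He HL Hu t x ltac:(lra)) as Hu0.
  pose proof (classical_solution_le_barrier n f p C e L k u Hlip HC HfC Hp1 He HL Hk eq_refl HL2 Hu
    t x ltac:(lra)) as HuW.
  rewrite Rabs_pos_eq by easy. eapply Rle_trans; [apply HuW|].
  set (s := L * L). assert (Hs : 0 < s) by (unfold s; nra).
  pose proof (amp_bounds s k t Hs Hk ltac:(lra)) as Ha.
  pose proof (gauss_le (S n) s t x Hs ltac:(lra)) as Hg.
  assert (0 < gauss s t x) by apply exp_pos.
  assert (Hd : exp (- (INR (S n) / 2) * ln (1 + t / s)) <=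
    exp (INR (S n) / 2 * ln s) * Rpower t (- (INR (S n) / 2))).
  { unfold Rpower. rewrite <- exp_plus. apply exp_nondecr.
    assert (ln t - ln s <= ln (1 + t / s)).
    { rewrite <- Rcomplements.ln_div by lra.
      assert (0 < t / s) by (apply Rdiv_lt_0_compat; lra).
      apply Rcomplements.ln_le; lra. }
    nra. }
  unfold barrier.
  assert (2 * e * amp s k t * gauss s t x <= 4 * e * gauss s t x).
  { apply Rmult_le_compat_r; [lra|]. nra. }
  rewrite Rmult_assoc.
  assert (4 * e * gauss s t x <= 4 * e *
    (exp (INR (S n) / 2 * ln s) * Rpower t (- (INR (S n) / 2)))).
  { apply Rmult_le_compat_l; lra. }
  lra.
Qed.
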